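(* Let $(\Omega,\Sigma,\mu)$ be a complete and nonatomic finite measure space, and let $X$ be an Asplund space with $\mathrm{dens}(X)<\kappa(\mu)$. Let $\Gamma\colon\Omega\rightrightarrows X^*$ be an integrably bounded, $w^*$-scalarly measurable, Gelfand integrable multifunction with nonempty $w^*$-closed values, and let $I(\Gamma)=\int\Gamma\,d\mu$ denote its Gelfand integral. Then the set $\overline{I(\Gamma)}^{\,w^*}$ is $w^*$-compact and convex, and $\overline{I(\Gamma)}^{\,w^*}=I(\overline{\mathrm{co}}^{\,w^*}\Gamma)$.
   Context: All Banach spaces are real; $X^*$ is the topological dual of $X$, and $w^*$ refers to the weak$^*$ topology on $X^*$; $\overline{C}^{\,w^*}$ is the $w^*$-closure of $C\subset X^*$. A Banach space is Asplund if every continuous convex function on an open convex subset is Fréchet differentiable on a dense subset of it. A function $f\colon\Omega\to X^*$ is $w^*$-scalarly measurable if $\langle f(\cdot),x\rangle$ is measurable for every $x\in X$; a $w^*$-scalarly measurable $f$ is Gelfand integrable (equivalently, $w^*$-integrable) over $A\in\Sigma$ if there is $x_A^*\in X^*$ with $\langle x_A^*,x\rangle=\int_A\langle f(\omega),x\rangle d\mu$ for every $x\in X$; then $\int_A f\,d\mu:=x^*_A$ (and $A$ is omitted when $A=\Omega$). For a multifunction $\Gamma\colon\Omega\rightrightarrows X^*$, let $\mathcal S^1_\Gamma$ be the set of Gelfand integrable $f\colon\Omega\to X^*$ with $f(\omega)\in\Gamma(\omega)$ for a.e. $\omega$. The Gelfand integral of $\Gamma$ is $I(\Gamma)=\int\Gamma\,d\mu:=\{\int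 f\,d\mu\mid f\in\mathcal S^1_\Gamma\}$; $\Gamma$ is Gelfand integrable if this set is nonempty. The support function of a nonempty $C\subset X^*$ is $s(x,C):=\sup_{x^*\in C}\langle x^*,x\rangle$, $x\in X$. $\Gamma$ is $w^*$-scalarly measurable if $\omega\mapsto s(x,\Gamma(\omega))$ is measurable for every $x\in X$; it is integrably bounded if there is $\psi\in L^1(\mu)$ with $\sup_{x^*\in\Gamma(\omega)}\|x^*\|\le\psi(\omega)$ for every $\omega\in\Omega$. $\overline{\mathrm{co}}^{\,w^*}\Gamma$ is the multifunction assigning to $\omega$ the $w^*$-closure of the convex hull of $\Gamma(\omega)$. $\mathrm{dens}(X)$ is the smallest cardinality of a norm-dense subset of the open unit ball of $X$. For a cardinal $\kappa$, the measure $\mu$ is $\kappa$-additive if for every pairwise disjoint family $\mathcal E\subset\Sigma$ with $|\mathcal E|<\kappa$ we have $\bigcup\mathcal E\in\Sigma$ and $\mu(\bigcup\mathcal E)=\sum_{A\in\mathcal E}\mu(A)$ (the sum being the supremum of sums over finite subfamilies). The additivity $\kappa(\mu)$ is the largest cardinal $\kappa$ for which $\mu$ is $\kappa$-additive, or $\infty$ if $\mu$ is $\kappa$-additive for every $\kappa$. *)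

(* Defs.v *)
From HB Require Import structures.
From mathcomp Require Import all_boot all_order all_algebra.
From mathcomp Require Import all_classical all_reals all_analysis.
From mathcomp Require Import measurable_realfun.
Set Implicit Arguments.
Unset Strict Implicit.
Unset Printing Implicit Defensive.
Import Order.TTheory GRing.Theory Num.Theory.
Import numFieldNormedType.Exports.
Local Open Scope classical_set_scope.
Local Open Scope ring_scope.

Section Dual.
Context (R : realType) (X : normedModType R).

Definition dual_pred : {pred X -> R^o} :=
  [pred f | `[< linear f /\ continuous f >]].

Lemma dual_predP (f : X -> R^o) :
  reflect (linear f /\ continuous f) (f \in dual_pred).
Proof. exact: asboolP. Qed.

Lemma dual_pred_submod_closed : submod_closed dual_pred.
Proof.
split.
  apply/dual_predP; split; first by move=> a x y; rewrite scaler0 addr0.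
  by move=> x; exact: cvg_cst.
move=> a f g /dual_predP[lf cf] /dual_predP[lg cg]; apply/dual_predP; split.
  move=> b x y; rewrite /= !fctE lf lg !scalerDr !scalerA (mulrC a b).
  by rewrite addrACA.
by move=> x; apply: cvgD; [apply: cvgZr; exact: cf|exact: cg].
Qed.

HB.instance Definition _ :=
  GRing.isSubmodClosed.Build R (X -> R^o) dual_pred dual_pred_submod_closed.

Record dual := Dual { dual_val :> X -> R^o; _ : dual_val \in dual_pred }.

HB.instance Definition _ := [isSub for dual_val].
HB.instance Definition _ := [Choice of dual by <:].
HB.instance Definition _ := [SubChoice_isSubLmodule of dual by <:].

(* The canonical topology on [dual] is the weak* topology, i.e. pointwise
   convergence on X; the norm of the dual only appears as [dual_norm]. *)
HB.instance Definition _ := Topological.copy dual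
  (initial_topology (dual_val : dual -> {ptws X -> R^o})).

Definition dual_norm (f : dual) : \bar R :=
  ereal_sup [set `|f x|%:E | x in [set x : X | `|x| <= 1]].

(* The value may be infinite when C is unbounded. *)
Definition support_fun (x : X) (C : set dual) : \bar R :=
  ereal_sup [set (f x)%:E | f in C].

End Dual.

Definition convex_hull (R : numDomainType) (M : lmodType R) (A : set M) : set M :=
  smallest (@convex_set R M) A.

(* A function on U is represented by a total function; as U is open, its
   differentiability at points of U does not depend on the extension. *)
Definition asplund (R : realType) (X : completeNormedModType R) : Prop :=
  forall (U : set X) (f : X -> R^o),
    open U -> convex_set U -> convex_function U f -> {within U, continuous f} ->
    exists D : set X, [/\ D `<=` U, U `<=` closure D &
      forall x, D x -> differentiable f x].

(* A cardinal is represented by any set of that cardinality. *)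
Definition card_lt (T U : Type) (A : set T) (B : set U) : Prop :=
  (A #<= B)%card /\ ~ (B #<= A)%card.

Definition dense_in_unit_ball (R : realType) (X : normedModType R)
    (D : set X) : Prop :=
  D `<=` ball 0 1 /\ ball 0 1 `<=` closure D.

(* dens(X) = |D| *)
Definition is_dens (R : realType) (X : normedModType R) (D : set X) : Prop :=
  dense_in_unit_ball D /\
  forall E : set X, dense_in_unit_ball E -> (D #<= E)%card.

Section Measure.
Context d (T : measurableType d) (R : realType).
Variable mu : {measure set T -> \bar R}.

Definition atom (A : set T) : Prop :=
  [/\ measurable A, (0 < mu A)%E & forall B, measurable B -> B `<=` A ->
    mu B = 0%E \/ mu (A `\` B) = 0%E].

Definition nonatomic : Prop := forall A, ~ atom A.

Definition kappa_additive (K : Type) (kappa : set K) : Prop :=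
  forall E : set (set T), E `<=` measurable -> trivIset E id ->
    card_lt E kappa ->
    measurable (\bigcup_(A in E) A) /\
    mu (\bigcup_(A in E) A) = \esum_(A in E) mu A.

(* kappa(mu) = oo *)
Definition infinite_additivity : Prop :=
  forall (K : Type) (kappa : set K), kappa_additive kappa.

(* kappa(mu) = |kappa| *)
Definition is_additivity (K : Type) (kappa : set K) : Prop :=
  kappa_additive kappa /\
  forall (L : Type) (lambda : set L), kappa_additive lambda ->
    (lambda #<= kappa)%card.

Definition lt_additivity (U : Type) (D : set U) : Prop :=
  infinite_additivity \/
  exists (K : Type) (kappa : set K), is_additivity kappa /\ card_lt D kappa.

(* dens(X) < kappa(mu) *)
Definition dens_lt_additivity (X : normedModType R) : Prop :=
  exists D : set X, is_dens D /\ lt_additivity D.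

Context (X : normedModType R).
Implicit Types (f : T -> dual X) (G : T -> set (dual X)).

Definition wstar_scalarly_measurable f : Prop :=
  forall x : X, measurable_fun setT (fun w => f w x : R).

Definition is_gelfand_integral (A : set T) f (xA : dual X) : Prop :=
  forall x : X, mu.-integrable A (fun w => (f w x)%:E) /\
    (xA x)%:E = (\int[mu]_(w in A) (f w x)%:E)%E.

Definition gelfand_integrable (A : set T) f : Prop :=
  wstar_scalarly_measurable f /\
  exists xA : dual X, is_gelfand_integral A f xA.

Definition gelfand_selections G : set (T -> dual X) :=
  [set f | gelfand_integrable setT f /\ {ae mu, forall w, G w (f w)}].

Definition multi_integral G : set (dual X) :=
  [set xs | exists2 f, gelfand_selections G f & is_gelfand_integral setT f xs].

Definition multi_gelfand_integrable G : Prop := multi_integral G !=set0.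

Definition multi_wstar_scalarly_measurable G : Prop :=
  forall x : X, measurable_fun setT (fun w => support_fun x (G w)).

Definition integrably_bounded G : Prop :=
  exists psi : T -> R, mu.-integrable setT (fun w => (psi w)%:E) /\
    forall w, (ereal_sup [set dual_norm xs | xs in G w] <= (psi w)%:E)%E.

End Measure.

(* Main.v *)
Require Import Defs.
From HB Require Import structures.
From mathcomp Require Import all_boot all_order all_algebra.
From mathcomp Require Import all_classical all_reals all_analysis.
From mathcomp Require Import measurable_realfun.
From mathcomp Require Import ring lra.
From mathcomp Require wochoice.
Import Order.TTheory GRing.Theory Num.Theory.
Import numFieldNormedType.Exports.
Local Open Scope classical_set_scope.
Local Open Scope ring_scope.

Set Implicit Arguments.
Unset Strict Implicit.
Unset Printing Implicit Defensive.

(** Write s x w for the maximum of x over Gamma w, and G for the weak* closed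
    convex hull of Gamma, so that c is in G w iff c x <= s x w for all x.  The
    additivity of mu makes unions of measurable (null) sets indexed by a dense
    set D of directions measurable (null).  Maximising over Gamma w first in a
    direction x and then lexicographically along a well-order of D leaves one
    point, which is therefore a measurable selection f of Gamma with
    <f w, x> = s x w.  Since mu is nonatomic, the integral of Gamma is almost
    convex on every finite set of directions (approximate Lyapunov theorem), and
    it has the same support function as the integral of G, hence is weak* dense
    in the latter.
    Conversely, a weak* limit c of integrals of selections f is the value on the
    whole space of an ultrafilter limit of the vector measures A |-> int_A f.
    Its Radon-Nikodym densities g x, x in X, are additive in x and satisfy
    g x - g y <= s (x - y) almost everywhere, outside a single null set for x and
    y in the additive span of D; so g extends there to a selection of G with
    integral c. *)

(** * Unions of families indexed by a small set *)

(** The obstacle is that X need not be separable: a selection cannot be produced by a countable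
    exhaustion, and a transfinite recursion usually destroys measurability. Here it does not,
    because both of its operations act well on support functions. Passing to a face replaces the
    support function by a directional derivative, the limit of a sequence of difference quotients.
    For a chain of weak* compact sets, the maximum of y over the intersection is below r exactly
    when the maximum over some member is, so sublevel sets become unions along the index set. For
    the converse inclusion, selections along a filter have no almost everywhere limit; only their
    integrals over each set converge. The limit measure is a priori finitely additive, and
    domination by the integrable bound of Gamma restores countable additivity. Its densities are
    determined only up to null sets, one for each x, which is why additivity and the bound by s are
    first secured on finite sums from D and then extended by density. *)

Lemma exists_well_founded_total (I : eqType) : exists lt : I -> I -> Prop,
  [/\ well_founded lt, (forall x y z, lt x y -> lt y z -> lt x z) &
      forall x y, [\/ lt x y, x = y | lt y x]].
Proof.
have [R woR] := wochoice.well_ordering_principle I.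
have woP : wochoice.wo_chain R predT by move=> A _; exact: woR.
have anti x y : R x y -> R y x -> x = y.
  by move=> xy yx; apply: (wochoice.wo_chain_antisymmetric woP) => //; rewrite xy yx.
have tot x y : R x y || R y x by exact: (wochoice.wo_chainW woP).
pose lt x y := R x y /\ x <> y.
have wf : well_founded lt.
  move=> x; apply: contrapT => nx.
  have [|z [[zA zmin] _]] := woR [pred y | `[< ~ Acc lt y >]].
    by exists x; apply/asboolP.
  move: zA => /asboolP; apply; constructor => y [yz ynz].
  apply: contrapT => nAy; apply: ynz; apply: anti => //.
  by apply: zmin; apply/asboolP.
have tri x y : [\/ lt x y, x = y | lt y x].
  have [->|/eqP xy] := eqVneq x y; first by constructor 2.
  by case/orP: (tot x y) => r; [constructor 1|constructor 3; split=> // e; exact: xy].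
exists lt; split=> // x y z xy yz.
have asym u v : lt u v -> ~ lt v u.
  by move=> [uv nuv] [vu _]; apply: nuv; exact: anti.
case: (tri x z) => // [xz|zx]; first by subst z; case: (asym _ _ xy).
exfalso.
(* A cycle x < y < z < x would leave the set of these three points without a least element. *)
have : wochoice.nonempty [pred u | `[< [\/ u = x, u = y | u = z] >]].
  by exists x; apply/asboolP; constructor 1.
move=> /woR[u [[/asboolP uA umin] _]].
have mx : R u x by apply: umin; apply/asboolP; constructor 1.
have my : R u y by apply: umin; apply/asboolP; constructor 2.
have mz : R u z by apply: umin; apply/asboolP; constructor 3.
case: uA => e; subst u.
- by case: zx => zx; apply; exact: anti.
- by case: xy => xy; apply; exact: anti.
- by case: yz => yz; apply; exact: anti.
Qed.

Section UnionStable.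
Context d (T : measurableType d) (R : realType).
Variable mu : {measure set T -> \bar R}.

(** The form in which dens(X) < kappa(mu) is used. Neither disjointness nor cardinals occur in it,
    so it passes to images, products and finite lists of indices. *)
Definition union_stable (I : Type) : Prop :=
  forall A : I -> set T, (forall i, measurable (A i)) ->
    measurable (\bigcup_i A i) /\
    ((forall i, mu (A i) = 0%E) -> mu (\bigcup_i A i) = 0%E).

Lemma union_stable_nat : union_stable nat.
Proof.
move=> A mA; split; first exact: bigcupT_measurable.
move=> A0; apply/eqP; rewrite eq_le measure_ge0 andbT.
have := measure_sigma_subadditive mu mA (bigcupT_measurable _ mA) (@subset_refl _ _).
move=> /le_trans; apply.
by rewrite eseries0.
Qed.

Lemma union_stable_prod (I J : Type) :
  union_stable I -> union_stable J -> union_stable (I * J).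
Proof.
move=> sI sJ A mA.
have -> : \bigcup_i A i = \bigcup_i \bigcup_j A (i, j).
  apply/seteqP; split=> w [].
    by move=> [i j] _ Aw; exists i => //; exists j.
  by move=> i _ [j _ Aw]; exists (i, j).
have mB i : measurable (\bigcup_j A (i, j)) by apply: (sJ _ _).1.
split; first exact: (sI _ mB).1.
by move=> A0; apply: (sI _ mB).2 => i; apply: (sJ _ _).2.
Qed.

Lemma union_stable_image (I J : Type) (f : I -> J) :
  (forall j, exists i, f i = j) -> union_stable I -> union_stable J.
Proof.
move=> fs sI A mA.
have -> : \bigcup_j A j = \bigcup_i A (f i).
  apply/seteqP; split=> w [].
    by move=> j _ Aw; have [i fi] := fs j; exists i => //; rewrite fi.
  by move=> i _ Aw; exists (f i).
split; first by apply: (sI _ _).1.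
by move=> A0; apply: (sI _ _).2.
Qed.

(** Lists are a countable union of finite powers. They index the finite sums of elements of D, whose
    exceptional null sets have to be collected into one. *)
Lemma union_stable_seq (I : Type) : union_stable I -> union_stable (seq I).
Proof.
move=> sI.
have sn n : union_stable (n.-tuple I).
  elim: n => [|n IHn].
    apply: (@union_stable_image nat _ (fun=> [tuple])); last exact: union_stable_nat.
    by move=> t; exists 0%N; apply: val_inj; case: t => -[].
  apply: (@union_stable_image (I * n.-tuple I) _ (fun p => [tuple of p.1 :: p.2])).
    move=> t; exists (thead t, [tuple of behead t]).
    by rewrite /= [RHS]tuple_eta.
  exact: union_stable_prod.
move=> A mA.
have -> : \bigcup_s A s = \bigcup_n \bigcup_(t in [set: n.-tuple I]) A (tval t).
  apply/seteqP; split=> w [].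
    by move=> s _ Aw; exists (size s) => //; exists (in_tuple s).
  by move=> n _ [t _ Aw]; exists (tval t).
have mB n : measurable (\bigcup_(t in [set: n.-tuple I]) A (tval t)).
  by apply: (sn n _ _).1.
split; first exact: (union_stable_nat mB).1.
by move=> A0; apply: (union_stable_nat mB).2 => n; apply: (sn n _ _).2.
Qed.

(* Along a well-order, A i minus the union of the preceding sets is a disjoint
   family with the same union, whose members are measurable by induction. *)
Lemma union_stable_of_disjoint (I : eqType) :
  (forall E : set (set T), E `<=` measurable -> trivIset E id ->
     (E #<= [set: I])%card ->
     measurable (\bigcup_(A in E) A) /\
     mu (\bigcup_(A in E) A) = \esum_(A in E) mu A) ->
  union_stable I.
Proof.
move=> addI; have [lt [wf ltt tri]] := exists_well_founded_total I.
move=> A mA.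
pose B i := A i `\` \bigcup_(j in [set j | lt j i]) A j.
have BE (J : set I) : (forall i j, J i -> lt j i -> J j) ->
    \bigcup_(i in J) A i = \bigcup_(S in B @` J) S.
  move=> Jd; apply/seteqP; split=> w; last first.
    by move=> [_ [i Ji <-] [Aiw _]]; exists i.
  move=> [i Ji Aiw]; have {Aiw} : J i /\ A i w by [].
  elim/(well_founded_ind wf): i {Ji} => i IH [Ji Aiw].
  have [[j /= ji Ajw]|nj] := pselect ((\bigcup_(j in [set j | lt j i]) A j) w).
    by apply: (IH j) => //; split => //; exact: Jd ji.
  by exists (B i) => //; exists i.
have triB J : trivIset (B @` J) id.
  move=> _ _ [i _ <-] [j _ <-] [w [[Aiw nBi] [Ajw nBj]]].
  case: (tri i j) => [ij|->//|ji]; exfalso.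
    by apply: nBj; exists i.
  by apply: nBi; exists j.
have cB J : (B @` J #<= [set: I])%card.
  apply: card_le_trans (card_image_le _ _) _; exact: subset_card_le.
have step J : (forall i j, J i -> lt j i -> J j) ->
    (forall i, J i -> measurable (B i)) ->
    measurable (\bigcup_(i in J) A i) /\
    mu (\bigcup_(i in J) A i) = \esum_(S in B @` J) mu S.
  move=> Jd mB; rewrite BE//; apply: addI => //.
  by move=> _ [i Ji <-]; exact: mB.
have mB i : measurable (B i).
  elim/(well_founded_ind wf): i => i IH; apply: measurableD => //.
  by apply: (step _ _ _).1 => // j k /= ji kj; exact: ltt kj ji.
have [mU muU] : measurable (\bigcup_i A i) /\
    mu (\bigcup_i A i) = \esum_(S in B @` setT) mu S by apply: step.
split=> // A0; rewrite muU esum1// => _ [i _ <-].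
apply/eqP; rewrite eq_le measure_ge0 andbT -(A0 i).
by apply: le_measure; rewrite ?inE// => w [].
Qed.

Lemma union_stable_lt_additivity (U : choiceType) (D : set U) :
  lt_additivity mu D -> union_stable (set_type D).
Proof.
move=> ltD; apply: union_stable_of_disjoint => E mE tE cE.
have {}cE : (E #<= D)%card.
  by apply: card_le_trans cE _; rewrite (card_le_eql (card_setT D)); exact: card_lexx.
case: ltD => [inf|[K [kappa [[addk _] [Dk nkD]]]]].
  (* A cardinal strictly above that of [E] is required; the power set of [set T] serves. [S0] below
     is Cantor's diagonal set against an injection of this power set into [E]. *)
  apply: (inf _ [set: set (set T)]) => //; split.
    have /card_esym e : (set1 @` E #= E)%card.
      by apply: inj_card_eq => A B _ _ /seteqP[/(_ A erefl)].
    by rewrite (card_le_eql e); exact: subset_card_le.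
  move=> /card_leP[f].
  pose g (S : set (set T)) : set T := set_val (f (to_setT S)).
  have ginj : injective g.
    move=> S S' /val_inj e; have := @inj _ _ _ f _ _ (mem_setT _) (mem_setT _) e => h.
  by change (val (to_setT S) = val (to_setT S')); rewrite h.
  pose S0 := [set y | exists2 S, y = g S & ~ S y].
  have [S0g|nS0g] := pselect (S0 (g S0)).
    by have [S /ginj <- nS] := S0g; exact: nS.
  by case: (nS0g); exists S0.
apply: addk => //; split; first exact: card_le_trans Dk.
by move=> kE; apply: nkD; exact: card_le_trans cE.
Qed.

End UnionStable.

(** * The weak* topology *)

Lemma ultra_filter_fmap (T U : Type) (f : T -> U) (F : set_system T) :
  UltraFilter F -> UltraFilter (f @ F).
Proof.
move=> FU; split; first exact: fmap_proper_filter.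
move=> G PG FG; apply/seteqP; split=> // A GA.
have [//|FnA] := in_ultra_setVsetC (f @^-1` A) FU.
have := @filter_not_empty _ G _; case.
by rewrite -(setICr A); apply: filterI => //; exact: FG.
Qed.

Lemma ultra_bounded_cvg (R : realType) (S : Type) (U : set_system S)
    (f : S -> R) (M : R) : UltraFilter U -> U [set s | `|f s| <= M] ->
  exists l : R, (f @ U --> l) /\ `|l| <= M.
Proof.
move=> FU UM; have := @segment_compact R (- M) M.
rewrite compact_ultra => /(_ (f @ U) (ultra_filter_fmap f FU))[|l [/=]].
  by apply: (@filterS _ U _ _ _ _ UM) => s; rewrite /= in_itv /= ler_norml.
by rewrite in_itv /= -ler_norml => lM Ul; exists l.
Qed.

Section DualTopology.
Context (R : realType) (X : normedModType R).
Implicit Types (c : dual X) (x y : X).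

Lemma dual_linear c : linear (c : X -> R^o).
Proof. by have /dual_predP[] := valP c. Qed.

Lemma dual_continuous c : continuous (c : X -> R^o).
Proof. by have /dual_predP[] := valP c. Qed.

Lemma dual0r c : c 0 = 0.
Proof. by have := dual_linear c (-1) 0 0; rewrite scaleN1r oppr0 addr0 scaleN1r addNr. Qed.

Lemma dualDr c x y : c (x + y) = c x + c y.
Proof. by have := dual_linear c 1 x y; rewrite !scale1r. Qed.

Lemma dualZr c (a : R) x : c (a *: x) = a * c x.
Proof. by have := dual_linear c a x 0; rewrite !addr0 dual0r addr0. Qed.

Lemma dualNr c x : c (- x) = - c x.
Proof. by rewrite -scaleN1r dualZr mulN1r. Qed.

Lemma dualBr c x y : c (x - y) = c x - c y.
Proof. by rewrite dualDr dualNr. Qed.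

Lemma dual_sumr c (I : Type) (r : seq I) (F : I -> X) :
  c (\sum_(i <- r) F i) = \sum_(i <- r) c (F i).
Proof. by elim/big_ind2 : _ => [|a ? b ? <- <-|//]; rewrite ?dual0r ?dualDr. Qed.

Lemma dual_eq c c' : (forall x, c x = c' x) -> c = c'.
Proof. by move=> e; apply: val_inj; apply: funext. Qed.

Lemma bounded_linear_dual (f : X -> R^o) (M : R) : linear f ->
  (forall x, `|f x| <= M * `|x|) -> f \in @dual_pred R X.
Proof.
move=> lf fM; apply/dual_predP; split=> // x.
have fB u v : f (u - v) = f u - f v.
  by have := lf (-1) v u; rewrite !scaleN1r [- v + u]addrC => ->; rewrite addrC.
have M0 : 0 < `|M| + 1 by rewrite ltr_wpDl.
apply/cvgrPdist_lt => e e0; near=> y.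
rewrite -fB (le_lt_trans (fM _))//.
apply: (@le_lt_trans _ _ ((`|M| + 1) * `|x - y|)).
  by rewrite ler_wpM2r// (le_trans (ler_norm _))// lerDl.
rewrite mulrC -ltr_pdivlMr//.
near: y; apply: (@cvgr_dist_lt _ _ _ (nbhs x) _ id x) => //; exact: divr_gt0.
Unshelve. all: by end_near. Qed.

Lemma dual_cvgP (F : set_system (dual X)) c : Filter F ->
  (F --> c) <-> (forall x, (fun c' : dual X => c' x) @ F --> c x).
Proof.
move=> FF.
have key : (F --> c) <-> ((@dual_val R X : dual X -> {ptws X -> R^o}) @ F --> (c : {ptws X -> R^o})).
  split=> [Fc|Fc].
    by move=> A /(@initial_continuous _ _ (@dual_val R X : dual X -> {ptws X -> R^o}) c) /Fc.
  move=> A /= [_ [[B Bop <-] Bc] sBA].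
  apply: (filterS sBA); apply: Fc; exact: open_nbhs_nbhs.
split=> [/key Fc x|Fx]; last apply/key.
  move: Fc; rewrite (pointwise_cvgP).
  exact.
exact/pointwise_cvgP.
Qed.

Lemma dual_eval_continuous x : continuous (fun c : dual X => c x : R).
Proof.
move=> c; have : (nbhs c : set_system (dual X)) --> c by [].
by move=> /dual_cvgP; exact.
Qed.

(* Convergence of a filter is pointwise, so the sets of functionals that are
   e-close to c on a finite list form a basis of neighbourhoods of c. *)
Lemma dual_closureP (A : set (dual X)) c :
  closure A c <-> (forall (xs : seq X) (e : R), 0 < e ->
    exists2 a, A a & forall x, x \in xs -> `|c x - a x| < e).
Proof.
split=> [Ac xs e e0|Ac].
  have nb : nbhs c [set a : dual X | forall x, x \in xs -> `|c x - a x| < e].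
    elim: xs => [|x xs IH]; first by apply: filterS filterT => a _ x; rewrite in_nil.
    have nx : nbhs c [set a : dual X | `|c x - a x| < e].
      have /cvgrPdist_lt/(_ _ e0) := @dual_eval_continuous x c; exact.
    apply: filterS (filterI nx IH) => a [ax axs] y.
    by rewrite inE => /predU1P[->|]; [exact: ax|exact: axs].
  by have [a [Aa ?]] := Ac _ nb; exists a.
pose F : set_system (dual X) := filter_from
  [set p : seq X * R | 0 < p.2]
  (fun p => [set a | A a /\ forall x, x \in p.1 -> `|c x - a x| < p.2]).
have FF : ProperFilter F.
  apply: filter_from_proper.
    apply: filter_from_filter; first by exists ([::], 1) => /=.
    move=> [xs e] [ys f] /= e0 f0; exists (xs ++ ys, Num.min e f).
      by rewrite /= lt_min e0.
    move=> a /= [Aa h]; split; split=> // x xin.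
      by have := h x; rewrite mem_cat xin => /(_ erefl); rewrite lt_min => /andP[].
    by have := h x; rewrite mem_cat xin orbT => /(_ erefl); rewrite lt_min => /andP[].
  by move=> [xs e] /= e0; have [a Aa ?] := Ac xs e e0; exists a.
have Fc : F --> c.
  apply/dual_cvgP => x; apply/cvgrPdist_lt => e e0.
  by exists ([:: x], e) => //= a [_]; apply; rewrite inE.
move=> B /Fc [[xs e] /= e0 sB]; have [a Aa ?] := Ac xs e e0.
by exists a; split=> //; exact: sB.
Unshelve. all: by end_near. Qed.

(** By boundedness every evaluation converges along an ultrafilter on A; the limits form a linear
    functional with the same bound, and closedness of A catches it. *)
Lemma banach_alaoglu (A : set (dual X)) (M : R) : closed A ->
  (forall c, A c -> forall x, `|c x| <= M * `|x|) -> compact A.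
Proof.
move=> clA AM; rewrite compact_ultra => F FU FA.
pose ev x := fun c : dual X => c x : R.
have lim x : exists l : R, (ev x @ F --> l) /\ `|l| <= M * `|x|.
  apply: ultra_bounded_cvg; apply: (@filterS _ F _ A _ _ FA) => c /AM; exact.
have [l lP] := choice lim.
have llin : linear (l : X -> R^o).
  move=> a x y.
  have h1 : ev (a *: x + y) @ F --> l (a *: x + y) by have [] := lP (a *: x + y).
  have h2 : ev (a *: x + y) @ F --> a * l x + l y.
    rewrite (_ : ev _ = (fun c => a * ev x c + ev y c)); last first.
      by apply/funext => c; rewrite /ev dualDr dualZr.
    by apply: cvgD; [apply: cvgMr; have [] := lP x|have [] := lP y].
  exact: (cvg_unique _ h1 h2).
have lM : (l : X -> R^o) \in @dual_pred R X.
  by apply: (@bounded_linear_dual _ M) => // x; have [] := lP x.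
exists (Dual lM).
have Fl : F --> Dual lM by apply/dual_cvgP => x; have [] := lP x.
split=> //; apply: clA => B /Fl FB.
by have [c []] := filter_ex (filterI FA FB); exists c.
Qed.

End DualTopology.

(** * Support functions and faces *)

Lemma compact_chain_nonempty (S : topologicalType) (I : Type) (K : set S)
    (B : I -> set S) (i0 : I) : compact K ->
  (forall i, closed (B i)) -> (forall i, B i `<=` K) -> (forall i, B i !=set0) ->
  (forall i j, B i `<=` B j \/ B j `<=` B i) -> exists p, forall i, B i p.
Proof.
move=> cK clB BK B0 Bch.
have FF : ProperFilter (filter_from setT B).
  apply: filter_from_proper; last by move=> i _; exact: B0.
  apply: filter_from_filter; first by exists i0.
  move=> i j _ _; have [ij|ji] := Bch i j.
    by exists i => // p Bp; split=> //; exact: ij.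
  by exists j => // p Bp; split=> //; exact: ji.
have [|p [_ Fp]] := cK _ FF; first by exists i0.
exists p => i; apply: clB => U Up.
by have := Fp (B i) U; apply=> //; exists i.
Qed.

Section SupportFunction.
Context (R : realType) (X : normedModType R).
Implicit Types (C : set (dual X)) (c : dual X) (x y : X).

Definition wstar_compact C := [/\ C !=set0, closed C & compact C].

(** The real-valued support function. [fine] sends an infinite supremum to 0, so the value is
    meaningful on weak* compact sets, where the supremum is a maximum. *)
Definition dual_max x C : R := fine (support_fun x C).

Lemma dual_max_attained x C : wstar_compact C ->
  support_fun x C = (dual_max x C)%:E /\
  exists2 c, C c & c x = dual_max x C.
Proof.
move=> [C0 _ cC].
have [|c /set_mem Cc cmax] := @compact_EVT_max _ R (fun c : dual X => c x) C C0 cC.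
  exact/continuous_subspaceT/dual_eval_continuous.
have e : support_fun x C = (c x)%:E.
  apply/eqP; rewrite eq_le; apply/andP; split.
    by apply: ge_ereal_sup => _ [c' Cc' <-]; rewrite lee_fin cmax// inE.
  by apply: ereal_sup_ubound; exists c.
by rewrite /dual_max e; split=> //; exists c.
Qed.

Lemma dual_max_ub x C c : wstar_compact C -> C c -> c x <= dual_max x C.
Proof.
move=> wC Cc; rewrite -lee_fin; have [<- _] := dual_max_attained x wC.
by apply: ereal_sup_ubound; exists c.
Qed.

Lemma closed_eval_ge x (r : R) : closed [set c : dual X | r <= c x].
Proof.
apply: (@closed_comp (dual X) R (fun c => c x) [set t | r <= t]).
  by move=> c _; exact: dual_eval_continuous.
exact: closed_ge.
Qed.

Lemma closed_eval_le x (r : R) : closed [set c : dual X | c x <= r].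
Proof.
apply: (@closed_comp (dual X) R (fun c => c x) [set t | t <= r]).
  by move=> c _; exact: dual_eval_continuous.
exact: closed_le.
Qed.

Lemma wstar_compactI C (B : set (dual X)) : wstar_compact C -> closed B ->
  C `&` B !=set0 -> wstar_compact (C `&` B).
Proof.
by move=> [_ clC cC] clB n0; split=> //; [exact: closedI|exact: compact_closedI].
Qed.

Definition face x C : set (dual X) := C `&` [set c | dual_max x C <= c x].

Lemma face_compact x C : wstar_compact C -> wstar_compact (face x C).
Proof.
move=> wC; apply: wstar_compactI => //; first exact: closed_eval_ge.
by have [_ [c Cc cx]] := dual_max_attained x wC; exists c; split=> //=; rewrite cx.
Qed.

Lemma faceE x C c : wstar_compact C -> face x C c -> c x = dual_max x C.
Proof. by move=> wC [Cc cx]; apply/eqP; rewrite eq_le cx andbT dual_max_ub. Qed.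

(* The support function of a face is the directional derivative of the support
   function at the exposing direction. *)
Lemma dual_max_face_cvg x y C : wstar_compact C ->
  (fun n : nat => n.+1%:R *
     (dual_max (x + n.+1%:R^-1 *: y) C - dual_max x C)) @ \oo -->
  dual_max y (face x C).
Proof.
move=> wC; set m := dual_max y _; set q := fun n : nat => _.
have wF := face_compact x wC.
have ge_q n : m <= q n.
  have [_ [c Fc cy]] := dual_max_attained y wF.
  rewrite /q mulrC -ler_pdivrMr// lerBrDl.
  have := dual_max_ub (x + n.+1%:R^-1 *: y) wC Fc.1.
  by rewrite dualDr dualZr (faceE wC Fc) cy mulrC.
apply/cvgrPdist_lt => e e0; apply: contrapT => nq.
have bad N : exists2 n, (N <= n)%N & m + e <= q n.
  apply: contrapT => nb; apply: nq; exists N => // n /= Nn.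
  rewrite distrC ger0_norm ?subr_ge0// ltrBlDl ltNge; apply/negP => mq.
  by apply: nb; exists n.
(* If c maximises x + y/(n+1) over C, then q n <= c y; and since q n >= m, c x falls short of the
   maximum of x by at most K/(n+1). A point common to all [B N] therefore lies in the face, yet its
   value at y is at least m + e. *)
pose K := dual_max y C - m.
pose B (N : nat) := C `&` ([set c | m + e <= c y] `&`
  [set c | dual_max x C - K / N.+1%:R <= c x]).
have K0 : 0 <= K.
  have [_ [c Fc cy]] := dual_max_attained y wF.
  by rewrite subr_ge0 /m -cy; apply: dual_max_ub => //; case: Fc.
have [|||||c Bc] := @compact_chain_nonempty _ nat C B 0%N.
- by case: wC.
- move=> N; apply: closedI; first by case: wC.
  by apply: closedI; exact: closed_eval_ge.
- by move=> N c [].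
- move=> N; have [n Nn qn] := bad N.
  have [_ [c Cc ce]] := dual_max_attained (x + n.+1%:R^-1 *: y) wC.
  move: ce; rewrite dualDr dualZr => ce.
  have cx := dual_max_ub x wC Cc; have cy := dual_max_ub y wC Cc.
  have qc : q n <= c y.
    rewrite /q -ce mulrC -ler_pdivlMr// lerBlDl (mulrC (c y)).
    by rewrite lerD2r.
  exists c; split=> //; split=> /=; first exact: le_trans qc.
  apply: (@le_trans _ _ (dual_max x C - K / n.+1%:R)).
    by rewrite lerB// ler_wpM2l// lef_pV2 ?posrE// ler_nat.
  have := ge_q n; rewrite /q -ce mulrC -ler_pdivrMr// => h.
  have : c y / n.+1%:R <= dual_max y C / n.+1%:R by rewrite ler_wpM2r.
  move: h; rewrite /K mulrBl (mulrC _ (c y)) => h1 h2.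
  have lin (a1 a2 a3 a4 a5 : R) : a1 <= a4 + a2 - a5 -> a2 <= a3 ->
    a5 - (a3 - a1) <= a4 by lra.
  exact: lin h1 h2.
- move=> i j; wlog ij : i j / (i <= j)%N.
    by move=> H; have [/H//|/ltnW/H[]] := leqP i j; [right|left].
  right=> c [Cc [cy /= cx]]; split=> //; split=> //=; apply: le_trans cx.
  by rewrite lerB// ler_wpM2l// lef_pV2 ?posrE// ler_nat.
have Fc : face x C c.
  split; first by case: (Bc 0%N).
  apply/ler_addgt0Pr => d d0 /=.
  have [N] : exists N : nat, K / N.+1%:R < d.
    exists (Num.trunc (K / d)).
    by rewrite ltr_pdivrMr// mulrC -ltr_pdivrMr// truncnS_gt.
  case: (Bc N) => _ [_ /= h] KN.
  by rewrite -lerBlDr (le_trans _ h)// lerB// ltW.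
have := dual_max_ub y wF Fc; case: (Bc 0%N) => _ [/= h _].
by move=> /(le_trans h); rewrite -/m gerDl leNgt e0.
Qed.

Section Chain.
Context (I : Type) (i0 : I) (B : I -> set (dual X)).
Hypothesis wB : forall i, wstar_compact (B i).
Hypothesis chB : forall i j, B i `<=` B j \/ B j `<=` B i.

Let bigcap_ge y (r : R) : (forall i, r <= dual_max y (B i)) ->
  exists c, forall i, B i c /\ r <= c y.
Proof.
move=> rB; pose B' i := B i `&` B i0 `&` [set c | r <= c y].
have clB' i : closed (B' i).
  apply: closedI; last exact: closed_eval_ge.
  by apply: closedI; [case: (wB i)|case: (wB i0)].
have [||||c Bc] := @compact_chain_nonempty _ I (B i0) B' i0 _ clB'.
- by case: (wB i0).
- by move=> i c [[]].
- move=> i; have [ii0|i0i] := chB i i0.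
    have [_ [c Bc cy]] := dual_max_attained y (wB i).
    by exists c; split; [split=> //; exact: ii0|rewrite /= cy].
  have [_ [c Bc cy]] := dual_max_attained y (wB i0).
  by exists c; split; [split=> //; exact: i0i|rewrite /= cy].
- move=> i j; have [ij|ji] := chB i j; [left|right] => c [[bi b0] r0].
    by split=> //; split=> //; exact: ij.
  by split=> //; split=> //; exact: ji.
by exists c => i; have [[]] := Bc i.
Qed.

Lemma bigcap_compact : wstar_compact (\bigcap_i B i).
Proof.
have [|c Bc] := @bigcap_ge 0 0.
  by move=> i; have [_ [c _ <-]] := dual_max_attained 0 (wB i); rewrite dual0r.
have e : \bigcap_i B i = B i0 `&` \bigcap_i B i.
  by apply/seteqP; split=> [a h|a []//]; split=> //; exact: h.
rewrite e; apply: wstar_compactI => //.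
  by apply: closed_bigI => i _; case: (wB i).
by rewrite -e; exists c => i _; case: (Bc i).
Qed.

(** By compactness, if every member of the chain reaches the level r at y, so does the intersection.
    The strict inequality is what turns a sublevel set into a union over the members, to which
    [union_stable] applies. *)
Lemma dual_max_bigcap_lt y (r : R) :
  dual_max y (\bigcap_i B i) < r <-> exists i, dual_max y (B i) < r.
Proof.
have wcap := bigcap_compact; split=> [lt_r|[i]].
  apply: contrapT => nex; have [|c Bc] := @bigcap_ge y r.
    by move=> i; rewrite leNgt; apply/negP => h; apply: nex; exists i.
  have : c y <= dual_max y (\bigcap_i B i).
    by apply: dual_max_ub => // i _; case: (Bc i).
  by have [_ rc] := Bc i0; move=> /(le_trans rc); rewrite leNgt lt_r.
apply: le_lt_trans; have [_ [c Bc <-]] := dual_max_attained y wcap.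
by apply: dual_max_ub => //; exact: Bc.
Qed.

End Chain.

End SupportFunction.

(** * Separation and convex hulls *)

Lemma convex_setP (R : numDomainType) (M : lmodType R) (A : set M) :
  convex_set A <-> (forall a b (t : R), 0 <= t -> t <= 1 -> A a -> A b ->
    A (t *: a + (1 - t) *: b)).
Proof.
split=> [cA a b t t0 t1 Aa Ab|cA a b t].
  by have /set_mem := cA a b (Itv01 t0 t1) (mem_set Aa) (mem_set Ab).
move=> /set_mem Aa /set_mem Ab; apply/mem_set.
exact: cA.
Qed.

(* Finite-dimensional separation: if p is not in the closure of the almost convex
   set K, moving a nearly closest point k towards a point maximising the linear
   form p - k over K brings it strictly closer to p. *)
Lemma approx_separation (R : realType) (I : eqType) (xs : seq I)
    (K : set (I -> R)) (p : I -> R) (M : R) :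
  K !=set0 -> 0 <= M ->
  (forall k x, K k -> x \in xs -> `|p x - k x| <= M) ->
  (forall k k' (t e : R), K k -> K k' -> 0 <= t -> t <= 1 -> 0 < e ->
    exists2 k'', K k'' &
      forall x, x \in xs -> `|k'' x - (k x + t * (k' x - k x))| < e) ->
  (forall a : I -> R, exists2 k, K k &
    \sum_(x <- xs) a x * p x <= \sum_(x <- xs) a x * k x) ->
  forall e : R, 0 < e -> exists2 k, K k & forall x, x \in xs -> `|p x - k x| < e.
Proof.
move=> [k0 Kk0] M0 KM Kconv Ksep e e0.
pose Phi (k : I -> R) := \sum_(x <- xs) (p x - k x) ^+ 2.
pose delta := inf (Phi @` K).
apply: contrapT => far.
have Phi_e k : K k -> e ^+ 2 <= Phi k.
  move=> Kk; rewrite leNgt; apply/negP => lt_e; apply: far; exists k => // x xin.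
  rewrite ltNge; apply/negP => le_e; move: lt_e; apply/negP; rewrite -leNgt.
  apply: (@le_trans _ _ (`|p x - k x| ^+ 2)).
    by rewrite lerXn2r// nnegrE ltW.
  rewrite real_normK ?num_real// /Phi (big_rem x)//= lerDl.
  by apply: sumr_ge0 => y _; exact: sqr_ge0.
have infP : has_inf (Phi @` K).
  split; first by exists (Phi k0), k0.
  by exists (e ^+ 2) => _ [k Kk <-]; exact: Phi_e.
have d0 : 0 < delta.
  apply: (@lt_le_trans _ _ (e ^+ 2)); first exact: exprn_gt0.
  by apply: lb_le_inf; [case: infP|move=> _ [k Kk <-]; exact: Phi_e].
have dPhi k : K k -> delta <= Phi k.
  by move=> Kk; apply: ge_inf; [case: infP|exists k].
pose B : R := \sum_(x <- xs) (2 * M) ^+ 2.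
have B0 : 0 <= B by apply: sumr_ge0 => x _; exact: sqr_ge0.
(* [B] bounds the squared distance of two points of K. Since t * B <= delta, the quadratic term of a
   move by t costs at most t * delta, against a linear gain of at least 2 * t * delta. *)
pose t : R := delta / (B + delta).
have Bd0 : 0 < B + delta by rewrite ltr_wpDl.
have t0 : 0 < t by exact: divr_gt0.
have t1 : t <= 1 by rewrite ler_pdivrMr// mul1r lerDr.
have tB : t * B <= delta.
  by rewrite /t mulrAC ler_pdivrMr// (ler_wpM2l (ltW d0))// lerDl ltW.
clearbody t.
(* The net gain t * delta absorbs two errors of a quarter each: [k] is only nearly closest, and
   [k''] only approximates [kt]. *)
have td0 : 0 < t * delta / 4 by rewrite divr_gt0// mulr_gt0.
have [_ [k Kk <-] kd] := inf_adherent td0 infP; rewrite -/delta in kd.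
have [k' Kk' k'max] := Ksep (fun x => p x - k x).
pose kt x := k x + t * (k' x - k x).
pose n2M : R := \sum_(x <- xs) (2 * M) + 1.
have n2M0 : 0 < n2M.
  by rewrite ltr_wpDl// sumr_ge0// => x _; rewrite mulr_ge0.
have eta0 : 0 < t * delta / 4 / n2M by exact: divr_gt0.
have [k'' Kk'' k''t] := Kconv k k' t _ Kk Kk' (ltW t0) t1 eta0.
have ktM x : x \in xs -> `|p x - kt x| <= M.
  move=> xin.
  have -> : p x - kt x = (1 - t) * (p x - k x) + t * (p x - k' x).
    by rewrite /kt; ring.
  rewrite (le_trans (ler_normD _ _))// !normrM (ger0_norm (ltW t0)).
  rewrite (@ger0_norm _ (1 - t)) ?subr_ge0//.
  have h1 := KM k x Kk xin; have h2 := KM k' x Kk' xin.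
  rewrite [leRHS](_ : _ = (1 - t) * M + t * M); last by ring.
  by apply: lerD; apply: ler_wpM2l; rewrite ?subr_ge0// ltW.
have Phikt : Phi kt <= Phi k - 2 * t * Phi k + t * delta.
  have -> : Phi kt = Phi k - 2 * t * (\sum_(x <- xs) (p x - k x) * (k' x - k x))
      + t * (t * \sum_(x <- xs) (k' x - k x) ^+ 2).
    rewrite /Phi !mulr_sumr -sumrN -!big_split /=; apply: eq_bigr => x _.
    by rewrite /kt; ring.
  apply: lerD; last first.
    apply: ler_wpM2l; first exact: ltW.
    apply: le_trans tB; apply: ler_wpM2l; first exact: ltW.
    rewrite /B !big_seq; apply: ler_sum => x xin.
    rewrite -[_ ^+ 2]real_normK ?num_real// lerXn2r// ?nnegrE ?mulr_ge0//.
    have h1 := KM k x Kk xin; have h2 := KM k' x Kk' xin.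
    have -> : k' x - k x = (p x - k x) - (p x - k' x) by ring.
    by rewrite (le_trans (ler_normB _ _))// mulr2n mulrDl mul1r lerD.
  apply: lerB => //; apply: ler_wpM2l; first by rewrite mulr_ge0// ltW.
  rewrite (_ : \sum_(x <- xs) (p x - k x) * (k' x - k x) =
    \sum_(x <- xs) (p x - k x) * k' x - \sum_(x <- xs) (p x - k x) * p x + Phi k).
    by rewrite lerDr subr_ge0.
  rewrite /Phi -sumrB -big_split /=; apply: eq_bigr => x _; ring.
have Phik'' : Phi k'' <= Phi kt + t * delta / 4.
  apply: (@le_trans _ _ (Phi kt + \sum_(x <- xs) (t * delta / 4 / n2M) * (2 * M))).
    rewrite /Phi -big_split /= !big_seq; apply: ler_sum => x xin.
    have -> : (p x - k'' x) ^+ 2 = (p x - kt x) ^+ 2 +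
      (kt x - k'' x) * ((p x - k'' x) + (p x - kt x)) by ring.
    rewrite lerD2l (le_trans (ler_norm _))// normrM ler_pM//.
      by rewrite distrC ltW// k''t.
    rewrite (le_trans (ler_normD _ _))// mulr2n mulrDl mul1r.
    by rewrite lerD ?ktM//; exact: KM.
  rewrite lerD2l -mulr_sumr mulrAC ler_pdivrMr// (ler_wpM2l (ltW td0))//.
  by rewrite /n2M lerDl.
have := dPhi _ Kk''; have := dPhi _ Kk => h1 h2.
have : t * delta <= t * Phi k by rewrite ler_wpM2l// ltW.
move: (Phi k) (Phi k'') (Phi kt) h1 h2 kd Phikt Phik'' => a b c.
rewrite -(mulrA 2 t a); move: td0; move: (t * delta) (t * a) => u v *; lra.
Qed.

Section ConvexHull.
Context (R : realType) (X : normedModType R).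
Implicit Types (C : set (dual X)) (c : dual X) (x y : X).

Lemma convex_hull_convex C : convex_set (convex_hull C).
Proof.
apply/convex_setP => a b t t0 t1 ha hb A [/[dup] cA /convex_setP cA' CA].
by apply: cA' => //; [apply: ha|apply: hb].
Qed.

Lemma convex_hull_dual_max C c x : wstar_compact C ->
  convex_hull C c -> c x <= dual_max x C.
Proof.
move=> wC hc; apply: (hc [set c' : dual X | c' x <= dual_max x C]).
split; last by move=> a Ca /=; exact: dual_max_ub.
apply/convex_setP => a b t t0 t1 ha hb.
change (t * a x + (1 - t) * b x <= dual_max x C).
rewrite (_ : dual_max x C = t * dual_max x C + (1 - t) * dual_max x C); last by ring.
by apply: lerD; apply: ler_wpM2l => //; rewrite subr_ge0.
Qed.

(** The Hahn-Banach description of a weak* closed convex hull by half-spaces. Weak* closure tests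
    finitely many vectors at a time, and on these coordinates a linear form is evaluation at a
    linear combination of the vectors, which attains its maximum on C. *)
Lemma dual_max_closure_convex_hull C c : wstar_compact C ->
  closure (convex_hull C) c <-> (forall x, c x <= dual_max x C).
Proof.
move=> wC; split=> [cc x|cC].
  have clA := @closed_eval_le R X x (dual_max x C).
  apply: (clA c) => U /cc[a [ha Ua]]; exists a; split=> //.
  exact: convex_hull_dual_max.
apply/dual_closureP => xs e e0.
pose b x := `|dual_max x C| + `|dual_max (- x) C|.
have leb c' x : (forall y, c' y <= dual_max y C) -> `|c' x| <= b x.
  move=> c'C; rewrite ler_norml /b; apply/andP; split.
    have := c'C (- x); rewrite dualNr => h; rewrite lerNl (le_trans h)//.
    by rewrite (le_trans (ler_norm _))// lerDr.
  by rewrite (le_trans (c'C x))// (le_trans (ler_norm _))// lerDl.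
have hullS : C `<=` convex_hull C by exact: sub_gen_smallest.
pose K := [set (c' : X -> R) | c' in convex_hull C].
have b0 x : 0 <= b x by exact: addr_ge0.
have [|||||k [c' hc' <-] h] := @approx_separation R X xs K c
    (\sum_(x <- xs) (b x + b x)) _ _ _ _ _ e e0.
- by have [[a Ca] _ _] := wC; exists a, a => //; exact: hullS.
- by apply: sumr_ge0 => x _; rewrite addr_ge0.
- move=> _ x [a ha <-] xin; rewrite (big_rem x)//=.
  apply: (@le_trans _ _ (b x + b x)).
    rewrite (le_trans (ler_normB _ _))// lerD//; apply: leb => //.
    by move=> y; exact: convex_hull_dual_max.
  by rewrite lerDl; apply: sumr_ge0 => y _; rewrite addr_ge0.
- move=> _ _ t e' [a ha <-] [a' ha' <-] t0 t1 e'0.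
  exists ((t *: a' + (1 - t) *: a : dual X) : X -> R).
    exists (t *: a' + (1 - t) *: a) => //.
    by apply: (convex_setP (convex_hull C)).1 => //; exact: convex_hull_convex.
  move=> x _; change (`|t * a' x + (1 - t) * a x - (a x + t * (a' x - a x))| < e').
  by rewrite (_ : _ - _ = 0) ?normr0//; ring.
- move=> a; have [_ [k Ck kx]] := dual_max_attained (\sum_(x <- xs) a x *: x) wC.
  exists k; first by exists k => //; exact: hullS.
  have := cC (\sum_(x <- xs) a x *: x).
  rewrite -kx !dual_sumr.
  by under eq_bigr do rewrite dualZr; under [X in _ <= X]eq_bigr do rewrite dualZr.
by exists c'.
Qed.

End ConvexHull.

(** * Measurable selections *)

Section LexicographicSelection.
Context d (T : measurableType d) (R : realType).
Context (mu : {measure set T -> \bar R}) (X : normedModType R).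
Implicit Types (G : T -> set (dual X)) (x y : X).

Definition measurable_multi G : Prop :=
  (forall w, wstar_compact (G w)) /\
  forall x, measurable_fun setT (fun w => dual_max x (G w)).

Lemma measurable_multi_face x G :
  measurable_multi G -> measurable_multi (fun w => face x (G w)).
Proof.
move=> [wG mG]; split=> [w|y]; first exact: face_compact.
apply: (measurable_fun_cvg
  (h := fun n w => n.+1%:R * (dual_max (x + n.+1%:R^-1 *: y) (G w) - dual_max x (G w)))).
  move=> n; apply: measurable_funM; first exact: measurable_cst.
  by apply: measurable_funB; exact: mG.
by move=> w _; exact: dual_max_face_cvg.
Qed.

Context (I : eqType) (stI : union_stable mu I).

Lemma measurable_multi_bigcap G (P : I -> Prop) (F : I -> T -> set (dual X)) :
  measurable_multi G -> (forall i, P i -> measurable_multi (F i)) ->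
  (forall i w, P i -> F i w `<=` G w) ->
  (forall i j w, P i -> P j -> F i w `<=` F j w \/ F j w `<=` F i w) ->
  measurable_multi (fun w => G w `&` [set c | forall i, P i -> F i w c]).
Proof.
move=> [wG mG] mF FG chF.
(* [None] stands for G itself, so that the chain is nonempty even if no index satisfies P, as
   happens at the least element of the well-order. *)
pose B w (o : option {i | P i}) := if o is Some i then F (sval i) w else G w.
have wB w o : wstar_compact (B w o).
  by case: o => [[i Pi]|] //=; case: (mF i Pi).
have chB w o o' : B w o `<=` B w o' \/ B w o' `<=` B w o.
  case: o => [[i Pi]|]; case: o' => [[j Pj]|] /=; last by left.
  - exact: chF.
  - by left; exact: FG.
  - by right; exact: FG.
have eB w : G w `&` [set c | forall i, P i -> F i w c] = \bigcap_o B w o.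
  apply/seteqP; split=> [c [Gc Fc] [[i Pi]|] _ //=|c Bc]; first exact: Fc.
  split; first exact: (Bc None).
  by move=> i Pi; apply: (Bc (Some (exist _ i Pi))).
split=> [w|y]; first by rewrite eB; exact: (bigcap_compact None).
apply: (measurability _ (RGenInftyO.measurableE R)) => // _ [_ [r ->] <-].
rewrite setTI.
have -> : (fun w => dual_max y (G w `&` [set c | forall i, P i -> F i w c])) @^-1`
    `]-oo, r[%classic = [set w | dual_max y (G w) < r] `|`
    \bigcup_i [set w | P i /\ dual_max y (F i w) < r].
  apply/seteqP; split=> w; rewrite /= in_itv /= eB.
    move=> /(dual_max_bigcap_lt None (wB w) (chB w))[[[i Pi]|] /= h]; [right|by left].
    by exists i.
  move=> h; apply/(dual_max_bigcap_lt None (wB w) (chB w)).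
  by case: h => [h|[i _ [Pi h]]]; [exists None|exists (Some (exist _ i Pi))].
have mlt (f : T -> R) : measurable_fun setT f -> measurable [set w | f w < r].
  move=> mf; have := mf measurableT `]-oo, r[%classic (measurable_itv _).
  by rewrite setTI; congr measurable; apply/seteqP; split=> w; rewrite /= in_itv.
apply: measurableU; first exact: mlt (mG y).
apply: (stI _).1 => i; have [Pi|nPi] := pselect (P i).
  have -> : [set w | P i /\ dual_max y (F i w) < r] = [set w | dual_max y (F i w) < r].
    by apply/seteqP; split=> w; [case|].
  by apply: mlt; case: (mF i Pi).
by rewrite (_ : mkset _ = set0) //; apply/seteqP; split=> w [].
Qed.

Context (lt : I -> I -> Prop) (wf_lt : well_founded lt).
Hypothesis lt_total : forall i j, [\/ lt i j, i = j | lt j i].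
Variable dir : I -> X.

(* The points of C that maximise [dir j] lexicographically over all j < i. *)
Definition lex_max (C : set (dual X)) : I -> set (dual X) :=
  Fix wf_lt (fun=> set (dual X)) (fun i rec =>
    C `&` [set c | forall j (ji : lt j i), face (dir j) (rec j ji) c]).

Lemma lex_maxE C i : lex_max C i =
  C `&` [set c | forall j, lt j i -> face (dir j) (lex_max C j) c].
Proof.
rewrite /lex_max Fix_eq// => {}i f g fg.
by congr (_ `&` _); apply/seteqP; split=> c h j ji; have := h j ji; rewrite fg.
Qed.

Lemma lex_max_le C i j : lt j i -> lex_max C i `<=` face (dir j) (lex_max C j).
Proof. by move=> ji c; rewrite lex_maxE => -[_]; apply. Qed.

(** The predicate P lets this serve twice: for the predecessors of i in the induction, and for all
    indices in the final set. The faces form a chain because each lexicographic set lies in all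
    earlier faces. *)
Lemma measurable_multi_lex G (P : I -> Prop) : measurable_multi G ->
  (forall i, P i -> measurable_multi (fun w => lex_max (G w) i)) ->
  measurable_multi (fun w => G w `&`
    [set c | forall i, P i -> face (dir i) (lex_max (G w) i) c]).
Proof.
move=> mG mL; apply: (@measurable_multi_bigcap G P
  (fun i w => face (dir i) (lex_max (G w) i))) => //.
- by move=> i Pi; apply: measurable_multi_face; exact: mL.
- by move=> i w _ c []; rewrite lex_maxE => -[].
- move=> i j w _ _; case: (lt_total i j) => [ij|->|ji]; [right|by left|left].
    by move=> c [/(lex_max_le ij)].
  by move=> c [/(lex_max_le ji)].
Qed.

Lemma measurable_selection G : measurable_multi G ->
  (forall c c' : dual X, (forall i, c (dir i) = c' (dir i)) -> c = c') ->
  exists f : T -> dual X, (forall w, G w (f w)) /\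
    forall x, measurable_fun setT (fun w => f w x : R).
Proof.
move=> mG sep.
have mL i : measurable_multi (fun w => lex_max (G w) i).
  elim/(well_founded_ind wf_lt): i => i IH.
  have -> : (fun w => lex_max (G w) i) = (fun w => G w `&`
      [set c | forall j, lt j i -> face (dir j) (lex_max (G w) j) c]).
    by apply/funext => w; rewrite -lex_maxE.
  exact: measurable_multi_lex.
have [wS mS] := measurable_multi_lex (P := fun=> True) mG (fun i _ => mL i).
have selP w : exists c, (G w `&` [set c | forall i, True ->
    face (dir i) (lex_max (G w) i) c]) c by case: (wS w).
have [f fP] := choice selP.
exists f; split=> [w|x]; first by case: (fP w).
(* Every [dir i] is constant on the remaining set, which is thus a singleton; evaluation at x
   coincides there with the support function, whose measurability is known. *)
suff e w : f w x = dual_max x (G w `&` [set c | forall i, True ->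
    face (dir i) (lex_max (G w) i) c]).
  by under eq_fun do rewrite e; exact: mS.
have [_ [c [Gc Lc] <-]] := dual_max_attained x (wS w).
congr (dual_val _ x); apply: sep => i.
have wL : wstar_compact (lex_max (G w) i) by case: (mL i).
rewrite (faceE wL (Lc i Logic.I)) (faceE wL) //.
by have [_] := fP w; apply.
Qed.

End LexicographicSelection.

Lemma exists_maximal_selection d (T : measurableType d) (R : realType)
    (mu : {measure set T -> \bar R}) (X : normedModType R) (I : eqType)
    (dir : I -> X) (G : T -> set (dual X)) (x : X) :
  union_stable mu I ->
  (forall c c' : dual X, (forall i, c (dir i) = c' (dir i)) -> c = c') ->
  measurable_multi G ->
  exists f : T -> dual X, [/\ forall w, G w (f w),
    forall y, measurable_fun setT (fun w => f w y : R) &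
    forall w, f w x = dual_max x (G w)].
Proof.
move=> stI sep mG; have [lt [wf _ tri]] := exists_well_founded_total I.
have [f [fF mf]] := measurable_selection stI wf tri (measurable_multi_face x mG) sep.
exists f; split=> // w; first by case: (fF w).
by apply: faceE => //; case: mG.
Qed.

(** * Nonatomic measures *)

Section Nonatomic.
Context d (T : measurableType d) (R : realType).
Context (mu : {measure set T -> \bar R}) (mu_fin : fin_num_fun mu).
Implicit Types A B C : set T.

Let m A : R := fine (mu A).

Let mE A : measurable A -> mu A = (m A)%:E.
Proof. by move=> mA; rewrite fineK// mu_fin. Qed.

Let m_ge0 A : 0 <= m A.
Proof. exact: fine_ge0. Qed.

Let le_m A B : measurable A -> measurable B -> A `<=` B -> m A <= m B.
Proof. by move=> mA mB AB; rewrite -lee_fin -!mE// le_measure// inE. Qed.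

Let mU A B : measurable A -> measurable B -> A `&` B = set0 ->
  m (A `|` B) = m A + m B.
Proof.
move=> mA mB AB; apply: EFin_inj; rewrite EFinD -!mE//; last exact: measurableU.
by rewrite measureU.
Qed.

Let mD A B : measurable A -> measurable B -> B `<=` A -> m (A `\` B) = m A - m B.
Proof.
move=> mA mB BA; rewrite -{2}(setDUK BA) mU ?setDIK//; last exact: measurableD.
by rewrite addrC addKr.
Qed.

Hypothesis natom : nonatomic mu.

(** A set that is not an atom splits into two parts of positive measure; the smaller one is kept. *)
Let half A : measurable A -> 0 < m A ->
  exists B, [/\ measurable B, B `<=` A, 0 < m B & m B <= m A / 2].
Proof.
move=> mA A0.
have [B [mB BA B0 AB0]] : exists B, [/\ measurable B, B `<=` A, m B != 0 &
    m (A `\` B) != 0].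
  apply: contrapT => nB; apply: (natom (A := A)); split=> //; first by rewrite mE.
  move=> B mB BA; have [B0|B0] := eqVneq (m B) 0; first by left; rewrite mE ?B0.
  have [AB0|AB0] := eqVneq (m (A `\` B)) 0.
    by right; rewrite mE ?AB0//; exact: measurableD.
  by exfalso; apply: nB; exists B.
have := mD mA mB BA; have {}B0 : 0 < m B by rewrite lt_neqAle eq_sym B0 m_ge0.
have {}AB0 : 0 < m (A `\` B) by rewrite lt_neqAle eq_sym AB0 m_ge0.
have [Bh e|Bh e] := leP (m B) (m A / 2); first by exists B.
exists (A `\` B); split=> //; first exact: measurableD.
by rewrite e; lra.
Qed.

Let small A (e : R) : measurable A -> 0 < m A -> 0 < e ->
  exists B, [/\ measurable B, B `<=` A, 0 < m B & m B <= e].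
Proof.
move=> mA A0 e0.
have H n : exists B, [/\ measurable B, B `<=` A, 0 < m B & m B <= m A / 2 ^+ n].
  elim: n => [|n [B [mB BA B0 Bn]]]; first by exists A; split=> //; rewrite expr0 divr1.
  have [B' [mB' B'B B'0 B'h]] := half mB B0.
  exists B'; split=> //; first exact: subset_trans BA.
  by rewrite exprSr invfM mulrA (le_trans B'h)// ler_pM2r.
have [n nA] : exists n : nat, m A / e <= n%:R.
  by exists (Num.trunc (m A / e)).+1; rewrite ltW// truncnS_gt.
have [B [mB BA B0 Bn]] := H n; exists B; split=> //.
rewrite (le_trans Bn)// ler_pdivrMr ?exprn_gt0// mulrC -ler_pdivrMr//.
by rewrite (le_trans nA)// -natrX ler_nat ltnW// ltn_expl.
Qed.

(** Greedy exhaustion: among the subsets of A of measure at most r that contain [F n], the next set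
    is within 1/(n+1) of the largest possible measure. If the union [U] stayed below r, a small set
    [C] of positive measure could be added to it, and near-maximality at each step would force m C
    <= 1/(n+1) for every n. *)
Lemma nonatomic_sierpinski A (r : R) : measurable A ->
  0 <= r -> (r%:E <= mu A)%E ->
  exists B, [/\ measurable B, B `<=` A & mu B = r%:E].
Proof.
move=> mA r0 rA; have {}rA : r <= m A by rewrite -lee_fin -mE.
pose good B := [/\ measurable B, B `<=` A & m B <= r].
have stepP (p : nat * set T) : exists B', good p.2 -> [/\ good B', p.2 `<=` B' &
    forall C, good C -> p.2 `<=` C -> m C <= m B' + p.1.+1%:R^-1].
  case: p => n B; have [gB|nB] := pselect (good B); last by exists B.
  pose E := [set m C | C in [set C | good C /\ B `<=` C]].
  have supE : has_sup E.
    split; first by exists (m B); exists B; split=> //.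
    by exists r => _ [C [[_ _ Cr] _] <-].
  have n0 : 0 < n.+1%:R^-1 :> R by [].
  have [_ [B' [gB' BB'] <-] B'n] := sup_adherent n0 supE.
  exists B' => _; split=> // C gC BC.
  rewrite -lerBlDr ltW// (le_lt_trans _ B'n)// lerD2r.
  by apply: ub_le_sup; [case: supE|exists C].
have [step stP] := choice stepP.
pose fix F n := if n is k.+1 then step (k, F k) else set0.
have gF n : good (F n).
  elim: n => [|n IH] /=; last by case: (stP (n, F n) IH).
  by split=> //; rewrite /m measure0.
have FS n : F n `<=` F n.+1 by case: (stP (n, F n) (gF n)).
have ndF : nondecreasing_seq F.
  by apply/nondecreasing_seqP => n; apply/subsetPset; exact: FS.
pose U := \bigcup_n F n.
have mF n : measurable (F n) by case: (gF n).
have mU' : measurable U by exact: bigcupT_measurable.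
have UA : U `<=` A by move=> w [n _]; case: (gF n) => _ + _; exact.
have Ur : m U <= r.
  have := @nondecreasing_cvg_mu _ _ _ mu F mF mU' ndF.
  rewrite -lee_fin -mE// => cv; rewrite -(cvg_lim _ cv)//.
  apply: lime_le; first exact: cvgP cv.
  by apply: nearW => n /=; rewrite mE// lee_fin; case: (gF n).
have gU : good U by [].
exists U; split=> //; rewrite mE//; congr EFin; apply/eqP.
rewrite eq_le Ur /= leNgt; apply/negP => Ult.
have AU0 : 0 < m (A `\` U) by rewrite mD// subr_gt0 (lt_le_trans Ult).
have mAU : measurable (A `\` U) by exact: measurableD.
have rU0 : 0 < r - m U by rewrite subr_gt0.
have [C [mC CAU C0 Cr]] := small mAU AU0 rU0.
have UC : U `&` C = set0.
  by apply/seteqP; split=> // w [Uw /CAU[]].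
have gUC : good (U `|` C).
  split; first exact: measurableU.
    by move=> w [/UA//|/CAU[]].
  by rewrite mU//; lra.
have key n : m C <= n.+1%:R^-1.
  have [_ _ /(_ _ gUC)] := stP (n, F n) (gF n); rewrite mU//= => h.
  have FU k : F k `<=` U by move=> w Fw; exists k.
  have := h (fun w Fw => or_introl (FU n w Fw)).
  have : m (step (n, F n)) <= m U by apply: (le_m (mF n.+1) mU'); exact: (FU n.+1).
  by move: (n.+1%:R^-1) => z; lra.
have := key (Num.trunc (m C)^-1); apply/negP; rewrite -ltNge.
by rewrite invf_plt ?posrE// truncnS_gt.
Qed.

(** C is quantified after the list, so that the induction hypothesis can be applied separately to
    the parts of C inside and outside the next set; the sets of the list may overlap. *)
Lemma nonatomic_split (l : seq (set T)) (t : R) : 0 <= t -> t <= 1 ->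
  (forall A, A \in l -> measurable A) ->
  forall C, measurable C -> exists B, [/\ measurable B, B `<=` C,
    mu B = (t%:E * mu C)%E &
    forall A, A \in l -> mu (B `&` A) = (t%:E * mu (C `&` A))%E].
Proof.
move=> t0 t1; elim: l => [|A l IH] ml C mC.
  have [||B [mB BC BE]] := @nonatomic_sierpinski C (t * m C) mC.
  - exact: mulr_ge0.
  - by rewrite mE// lee_fin ler_piMl.
  by exists B; split=> //; rewrite BE EFinM -mE.
have mA : measurable A by apply: ml; rewrite inE eqxx.
have {}ml A' : A' \in l -> measurable A' by move=> A'l; apply: ml; rewrite inE A'l orbT.
have [B1 [mB1 B1C B1E B1l]] := IH ml _ (measurableI _ _ mC mA).
have [B2 [mB2 B2C B2E B2l]] := IH ml _ (measurableD mC mA).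
have B12 : B1 `&` B2 = set0.
  by apply/seteqP; split=> // w [/B1C[_ Aw] /B2C[_ /(_ Aw)]].
exists (B1 `|` B2); split.
- exact: measurableU.
- by move=> w [/B1C[]|/B2C[]].
- transitivity (mu B1 + mu B2)%E; first exact: measureU.
  rewrite B1E B2E -ge0_muleDr ?measure_ge0//; congr (_ * _)%E.
  by rewrite [RHS](measureDI mu mC mA) addeC.
- move=> A'; rewrite inE => /predU1P[->|A'l].
    rewrite -B1E; congr (mu _); apply/seteqP; split=> w.
      by move=> [[//|/B2C[_ nA]] Aw].
    by move=> B1w; split; [left|case: (B1C _ B1w)].
  have mCA : measurable (C `&` A) by exact: measurableI.
  have mCD : measurable (C `\` A) by exact: measurableD.
  have mI' E : measurable E -> measurable (E `&` A').
    by move=> mE'; exact: measurableI (ml _ A'l).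
  transitivity (mu (B1 `&` A') + mu (B2 `&` A'))%E.
    rewrite setIUl; apply: measureU; [exact: mI'..|].
    by rewrite setIACA B12 set0I.
  rewrite B1l// B2l// -ge0_muleDr ?measure_ge0//; congr (_ * _)%E.
  have -> : C `&` A' = (C `&` A `&` A') `|` ((C `\` A) `&` A').
    by rewrite -setIUl setUIDK.
  apply/esym/measureU; [exact: mI'..|].
  by apply/seteqP; split=> // w [[[_ Aw] _] [[_ /(_ Aw)]]].
Qed.

End Nonatomic.

(** * Approximate convexity of integrals over a nonatomic measure *)

Section ApproximateLyapunov.
Import HBSimple.
Context d (T : measurableType d) (R : realType).
Context (mu : {finite_measure set T -> \bar R}).
Implicit Types (h g : T -> R).

Local Notation integrable_ h := (mu.-integrable setT (EFin \o h)).

Lemma Rintegral_indic (A B : set T) : measurable A -> measurable B ->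
  \int[mu]_(w in B) \1_A w = fine (mu (B `&` A)).
Proof. by move=> mA mB; rewrite /Rintegral integral_indic// setIC. Qed.

Let sub h B : measurable B -> integrable_ h -> mu.-integrable B (EFin \o h).
Proof. by move=> mB; exact: integrableS. Qed.

Variable t : R.
Hypotheses (t0 : 0 <= t) (t1 : t <= 1).

(* h is tested by finitely many sets up to any error: a set B which has a
   proportion t of each of them has a proportion t of the integral of h. *)
Definition splittable h : Prop := integrable_ h /\
  forall e : R, 0 < e -> exists2 l : seq (set T),
    (forall A, A \in l -> measurable A) &
    forall B, measurable B ->
      (forall A, A \in l -> mu (B `&` A) = (t%:E * mu A)%E) ->
      `|\int[mu]_(w in B) h w - t * \int[mu]_w h w| <= e.

Lemma splittable_indic A : measurable A -> splittable \1_A.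
Proof.
move=> mA; split; first exact: integrable_indic.
move=> e e0; exists [:: A]; first by move=> A'; rewrite inE => /eqP ->.
move=> B mB /(_ A); rewrite inE => /(_ (eqxx _)) BA.
rewrite !Rintegral_indic// setTI BA fineM ?fin_num_measure// subrr normr0.
exact: ltW.
Qed.

Lemma splittableZ (r : R) h : splittable h -> splittable (fun w => r * h w).
Proof.
move=> [ih sh]; split; first by have := integrableZl measurableT r ih.
move=> e e0; have r0 : 0 < `|r| + 1 by rewrite ltr_wpDl.
have [l ml lP] := sh (e / (`|r| + 1)) (divr_gt0 e0 r0); exists l => // B mB BA.
rewrite !RintegralZl//; last exact: sub.
rewrite mulrCA -mulrBr normrM.
apply: (@le_trans _ _ (`|r| * (e / (`|r| + 1)))); first by rewrite ler_wpM2l// lP.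
by rewrite mulrCA ler_piMr ?(ltW e0)// ler_pdivrMr// mul1r lerDl.
Qed.

Lemma splittableD h g : splittable h -> splittable g ->
  splittable (fun w => h w + g w).
Proof.
move=> [ih sh] [ig sg]; split; first by have := integrableD measurableT ih ig.
move=> e e0; have e20 : 0 < e / 2 by rewrite divr_gt0.
have [l ml lP] := sh _ e20; have [l' ml' lP'] := sg _ e20.
exists (l ++ l') => [A|B mB BA].
  by rewrite mem_cat => /orP[/ml|/ml'].
rewrite !RintegralD//; [|exact: sub..].
rewrite mulrDr opprD addrACA (le_trans (ler_normD _ _))// [leRHS](splitr e).
by apply: lerD; [apply: lP|apply: lP'] => // A Al; apply: BA; rewrite mem_cat Al ?orbT.
Qed.

Lemma splittable_sum (I : Type) (s : seq I) (h : I -> T -> R) :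
  (forall i, splittable (h i)) -> splittable (fun w => \sum_(i <- s) h i w).
Proof.
move=> sh; elim: s => [|i s IH].
  under eq_fun do rewrite big_nil.
  split; first exact: integrable0.
  move=> e e0; exists [::] => // B mB _.
  rewrite /Rintegral !integral0 /= mulr0 subrr normr0; exact: ltW.
by under eq_fun do rewrite big_cons; exact: splittableD.
Qed.

(** On every measurable set the integrals of h and g differ by at most their L1 distance. This
    accounts for two of the three errors e/3, the one on the whole space being multiplied by t <=
    1. *)
Lemma splittable_approx h : integrable_ h ->
  (forall e : R, 0 < e -> exists2 g, splittable g &
    \int[mu]_w `|h w - g w| <= e) -> splittable h.
Proof.
move=> ih hP; split=> // e e0; have e30 : 0 < e / 3 by rewrite divr_gt0.
have [g [ig sg] hg] := hP _ e30; have [l ml lP] := sg _ e30.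
exists l => // B mB BA; have gB := lP B mB BA.
have ihg : integrable_ (fun w => h w - g w).
  by have := integrableB measurableT ih ig.
have close C : measurable C ->
    `|\int[mu]_(w in C) h w - \int[mu]_(w in C) g w| <= e / 3.
  move=> mC; rewrite -RintegralB//; [|exact: sub..].
  rewrite (le_trans (le_normr_Rintegral mC (sub mC ihg)))// (le_trans _ hg)//.
  rewrite /Rintegral fine_le//.
  - apply: integrable_fin_num => //.
    exact/(integrableS measurableT)/(integrable_abse ihg).
  - by apply: integrable_fin_num => //; exact: integrable_abse ihg.
  - apply: ge0_subset_integral => //=.
    exact: (measurable_int mu (integrable_abse ihg)).
have hgB := close B mB; have hgT := close setT measurableT.
have -> : \int[mu]_(w in B) h w - t * \int[mu]_w h w =
    (\int[mu]_(w in B) h w - \int[mu]_(w in B) g w) +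
    (\int[mu]_(w in B) g w - t * \int[mu]_w g w) -
    t * (\int[mu]_w h w - \int[mu]_w g w) by ring.
have tT : `|t * (\int[mu]_w h w - \int[mu]_w g w)| <= e / 3.
  by rewrite normrM ger0_norm// (le_trans (ler_piMl _ t1)).
rewrite (le_trans (ler_normB _ _))//.
have := le_trans (ler_normD _ _) (lerD hgB gB).
move: tT; move: `|t * _| `|_ + _| => a b; lra.
Qed.

Lemma integrable_splittable h : integrable_ h -> splittable h.
Proof.
move=> ih; apply: splittable_approx => // e e0.
have [g_ [ig _ cv]] := approximation_sfun_integrable measurableT ih.
have {cv} : \forall n \near \oo, (\int[mu]_w `|(h w)%:E - (g_ n w)%:E| < e%:E)%E.
  move: cv => /fine_cvgP[fin /cvgrPdist_lt/(_ e e0)] cv.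
  apply: filterS2 fin cv => n finn; rewrite sub0r normrN => lt_e.
  by rewrite -[ltLHS]fineK// lte_fin (le_lt_trans (ler_norm _)).
move=> [n _ /(_ n (leqnn n)) gn]; exists (g_ n); last first.
  have {}gn : (\int[mu]_w (`|h w - g_ n w|)%:E < e%:E)%E by exact: gn.
  rewrite -lee_fin /Rintegral fineK; first exact: ltW.
  rewrite ge0_fin_numE; first exact: lt_trans gn (ltry _).
  by apply: integral_ge0 => w _; rewrite lee_fin.
have -> : (g_ n : T -> R) = (fun w =>
    \sum_(y <- finmap.enum_fset (fset_set (range (g_ n)))) (y * \1_(g_ n @^-1` [set y]) w)).
  by apply/funext => w; rewrite fimfunE fsbig_finite.
by apply: splittable_sum => y; apply/splittableZ/splittable_indic.
Qed.

(** The test lists of the finitely many functions are concatenated; a single set holding the exact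
    proportion t of each test set is then good for all the functions at once. *)
Lemma approximate_lyapunov (natom : nonatomic mu) (I : eqType) (xs : seq I)
    (h : I -> T -> R) (e : R) : 0 < e ->
  (forall i, i \in xs -> integrable_ (h i)) ->
  exists2 B, measurable B & forall i, i \in xs ->
    `|\int[mu]_(w in B) h i w - t * \int[mu]_w h i w| <= e.
Proof.
move=> e0 ih.
suff [l ml lP] : exists2 l : seq (set T), (forall A, A \in l -> measurable A) &
    forall B, measurable B -> (forall A, A \in l -> mu (B `&` A) = (t%:E * mu A)%E) ->
      forall i, i \in xs -> `|\int[mu]_(w in B) h i w - t * \int[mu]_w h i w| <= e.
  have [B [mB _ _ BA]] := nonatomic_split (fun A => fin_num_measure mu A) natom t0 t1 ml measurableT.
  by exists B => //; apply: lP => // A Al; rewrite BA// setTI.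
elim: xs ih => [|i s IH] ih; first by exists [::].
have [|l ml lP] := IH; first by move=> j js; apply: ih; rewrite inE js orbT.
have [_ /(_ e e0) [l' ml' lP']] : splittable (h i).
  by apply: integrable_splittable; apply: ih; rewrite inE eqxx.
exists (l ++ l') => [A|B mB BA j]; first by rewrite mem_cat => /orP[/ml|/ml'].
rewrite inE => /predU1P[->|js]; [apply: lP'|apply: lP] => // A Al;
  by apply: BA; rewrite mem_cat Al ?orbT.
Qed.

End ApproximateLyapunov.

(** * Densities *)

Section DominatedAdditive.
Context d (T : measurableType d) (R : realType).
Context (mu : {finite_measure set T -> \bar R}).
Context (psi : T -> R) (nu : set T -> R).
Hypothesis ipsi : mu.-integrable setT (EFin \o psi).
Hypothesis nuU : forall A B, measurable A -> measurable B -> A `&` B = set0 ->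
  nu (A `|` B) = nu A + nu B.
Hypothesis nu_le : forall A, measurable A -> `|nu A| <= \int[mu]_(w in A) psi w.

Let numu A : measurable A -> mu A = 0%E -> nu A = 0.
Proof.
move=> mA A0; apply/eqP; rewrite -normr_le0 (le_trans (nu_le mA))//.
rewrite /Rintegral null_set_integral//.
exact/measurable_funTS/(measurable_int mu ipsi).
Qed.

Let nu_ereal A := (nu A)%:E.

Let nu0 : nu_ereal set0 = 0%E.
Proof. by rewrite /nu_ereal numu// measure0. Qed.

Let nu_fin A : measurable A -> nu_ereal A \is a fin_num.
Proof. by []. Qed.

(** On the tail [U] minus [S n], |nu| is at most the integral of psi, which tends to 0 because the
    indefinite integral of psi is countably additive. *)
Let nu_sigma_additive : semi_sigma_additive nu_ereal.
Proof.
move=> F mF tF mUF.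
have Cpsi := @charge_semi_sigma_additive _ _ _ (induced_charge ipsi) F mF tF mUF.
pose S n := \big[setU/set0]_(0 <= i < n) F i.
have mS n : measurable (S n) by exact: bigsetU_measurable.
have SF n : S n `&` F n = set0.
  apply/seteqP; split=> // w []; rewrite /S big_mkord -bigcup_mkord => -[i /= ni Fiw] Fnw.
  have e : i = n by apply: (tF i n Logic.I Logic.I); exists w.
  by move: ni; rewrite e ltnn.
have SS n : S n.+1 = S n `|` F n by rewrite /S big_nat_recr.
have nuS n : (\sum_(0 <= i < n) nu_ereal (F i) = (nu (S n))%:E)%E.
  elim: n => [|n IH]; first by rewrite big_nil /S big_nil; exact: (esym nu0).
  by rewrite big_nat_recr//= IH SS nuU.
have psiE A : measurable A -> induced_charge ipsi A = (\int[mu]_(w in A) psi w)%:E.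
  move=> mA; rewrite /Rintegral fineK//; apply: integrable_fin_num => //.
  exact: integrableS ipsi.
have psiS n : (\sum_(0 <= i < n) induced_charge ipsi (F i) =
    (\int[mu]_(w in S n) psi w)%:E)%E.
  rewrite -psiE//; elim: n => [|n IH]; first by rewrite big_nil /S big_nil charge0.
  by rewrite big_nat_recr//= IH SS -chargeU.
set U := \bigcup_n F n in mUF Cpsi *.
have SU n : S n `<=` U.
  by rewrite /S big_mkord -bigcup_mkord => w [i _ Fw]; exists i.
have US n : S n `|` (U `\` S n) = U by rewrite setDUK.
have mUS n : measurable (U `\` S n) by exact: measurableD.
have psiU n : \int[mu]_(w in U `\` S n) psi w =
    \int[mu]_(w in U) psi w - \int[mu]_(w in S n) psi w.
  rewrite -{2}(US n) Rintegral_setU// ?US.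
  - by rewrite addrC addKr.
  - exact: integrableS ipsi.
  - by apply/disj_setPS => w [? []].
have nuUS n : nu U - nu (S n) = nu (U `\` S n).
  by rewrite -{1}(US n) nuU// ?setDIK// addrC addKr.
rewrite (_ : (fun n => _) = EFin \o (fun n => nu (S n))); last first.
  by apply/funext => n; exact: nuS.
apply: cvg_EFin; first by apply: nearW.
apply/cvgrPdist_lt => e e0.
have : (fun n => \int[mu]_(w in S n) psi w) @ \oo --> \int[mu]_(w in U) psi w.
  have {}Cpsi : ((fun n => \sum_(0 <= i < n) induced_charge ipsi (F i)) @ \oo -->
    induced_charge ipsi U)%E by exact: Cpsi.
  move: Cpsi; rewrite psiE//; under eq_fun do rewrite psiS.
  move=> /fine_cvgP[_]; exact.
move=> /cvgrPdist_lt/(_ e e0); apply: filterS => n.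
by rewrite -psiU nuUS; apply: le_lt_trans; rewrite (le_trans (nu_le _))// ler_norm.
Qed.

HB.instance Definition _ := isCharge.Build _ _ _ nu_ereal nu0 nu_fin nu_sigma_additive.

Lemma dominated_additive_density : exists g : T -> R,
  mu.-integrable setT (EFin \o g) /\
  forall A, measurable A -> nu A = \int[mu]_(w in A) g w.
Proof.
have dom : nu_ereal `<< mu.
  by move=> A A0 B mB BA; rewrite /nu_ereal numu//; exact: A0.
pose g := Radon_Nikodym nu_ereal mu.
have gE : EFin \o (fine \o g) = g.
  by apply/funext => w /=; rewrite fineK// Radon_Nikodym_fin_num.
exists (fine \o g); split; first by rewrite gE; exact: Radon_Nikodym_integrable.
move=> A mA; rewrite /Rintegral (_ : (fun w => _) = g); last exact: gE.
by rewrite -Radon_Nikodym_integral.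
Qed.

End DominatedAdditive.

(** * Comparison of functions up to null sets *)

Section NullSets.
Context d (T : measurableType d) (R : realType).
Context (mu : {measure set T -> \bar R}).
Implicit Types (h : T -> R).

Lemma measurable_lt_fun h1 h2 : measurable_fun setT h1 -> measurable_fun setT h2 ->
  measurable [set w | h1 w < h2 w].
Proof.
move=> m1 m2; have mtrue : measurable [set true] by [].
have := measurable_fun_ltr m1 m2 measurableT mtrue.
by rewrite setTI; congr measurable; apply/seteqP; split=> w.
Qed.

(** The hypothesis is tested on the exceptional set itself: there h1 - h2 is positive, yet its
    integral is at most 0. *)
Lemma integral_le_null h1 h2 :
  mu.-integrable setT (EFin \o h1) -> mu.-integrable setT (EFin \o h2) ->
  (forall A, measurable A -> \int[mu]_(w in A) h1 w <= \int[mu]_(w in A) h2 w) ->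
  mu [set w | h2 w < h1 w] = 0%E.
Proof.
move=> i1 i2 le12; set A := [set w | _].
have mh h : mu.-integrable setT (EFin \o h) -> measurable_fun setT h.
  by move=> /(measurable_int mu)/measurable_EFinP.
have mA : measurable A by apply: measurable_lt_fun; exact: mh.
have sub h : mu.-integrable setT (EFin \o h) -> mu.-integrable A (EFin \o h).
  by apply: integrableS.
have iB : mu.-integrable A (EFin \o (fun w => h1 w - h2 w)).
  by have := integrableB mA (sub _ i1) (sub _ i2).
have : (\int[mu]_(w in A) `|(h1 w - h2 w)%:E| = 0)%E.
  rewrite (eq_integral (fun w => (h1 w - h2 w)%:E)); last first.
    by move=> w /set_mem Aw; rewrite /= ger0_norm// subr_ge0 ltW.
  have fin : (\int[mu]_(w in A) (h1 w - h2 w)%:E \is a fin_num)%E.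
    exact: integrable_fin_num iB.
  rewrite -(fineK fin); congr EFin; apply/eqP; rewrite eq_le.
  rewrite [X in X <= 0 <= X](_ : _ = \int[mu]_(w in A) (h1 w - h2 w))//.
  rewrite Rintegral_ge0 ?andbT; last by move=> w Aw; rewrite subr_ge0 ltW.
  by rewrite RintegralB// ?subr_le0 ?le12//; exact: sub.
move=> /(ae_eq_integral_abs mu mA (measurable_int mu iB))[N [mN N0 sN]].
apply/eqP; rewrite eq_le measure_ge0 andbT -N0 le_measure ?inE// => w Aw.
apply: sN => /= /(_ Aw) [] /eqP; rewrite subr_eq0 => /eqP e.
by move: Aw; rewrite /A /= e ltxx.
Qed.

Lemma Rintegral_null_eq (N : set T) h1 h2 : measurable N -> mu N = 0%E ->
  (forall w, ~ N w -> h1 w = h2 w) ->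
  mu.-integrable setT (EFin \o h1) -> measurable_fun setT h2 ->
  mu.-integrable setT (EFin \o h2) /\
  forall A, measurable A -> \int[mu]_(w in A) h2 w = \int[mu]_(w in A) h1 w.
Proof.
move=> mN N0 e12 i1 m2.
have m1 : measurable_fun setT (EFin \o h1) := measurable_int mu i1.
have m2' : measurable_fun setT (EFin \o h2) by exact/measurable_EFinP.
split.
  apply/(negligible_integrable mN measurableT m2' N0).
  apply: (eq_integrable _ (EFin \o h1)); first exact: measurableD.
    by move=> w /set_mem[_ nN] /=; rewrite e12.
  exact/(negligible_integrable mN measurableT m1 N0).
move=> A mA; congr fine; apply: ae_eq_integral => //.
- exact: measurable_funTS.
- exact: measurable_funTS.
- exists N; split=> // w /= nw; apply: contrapT => /e12 e; apply: nw.
  by rewrite /= e.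
Qed.

Lemma le_Rintegral_null (N A : set T) h1 h2 : measurable N -> mu N = 0%E ->
  (forall w, ~ N w -> h1 w <= h2 w) -> measurable A ->
  mu.-integrable setT (EFin \o h1) -> mu.-integrable setT (EFin \o h2) ->
  \int[mu]_(w in A) h1 w <= \int[mu]_(w in A) h2 w.
Proof.
move=> mN N0 le12 mA i1 i2.
(* The minimum equals h1 off N and is below h2 everywhere, which reduces the comparison to a
   pointwise one. *)
have mmin : measurable_fun setT (fun w => Num.min (h1 w) (h2 w)).
  by apply: measurable_minr; apply/measurable_EFinP; exact: (measurable_int mu).
have [|imin <-//] := Rintegral_null_eq mN N0 _ i1 mmin.
  by move=> w /le12 ?; rewrite min_l.
apply: le_Rintegral => //; [exact: integrableS imin|exact: integrableS i2|].
by move=> w _; rewrite ge_min lexx orbT.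
Qed.

(** The preimages under h1 and h2 differ only inside N, and completeness makes every subset of N
    measurable. *)
Lemma complete_measurable_null_eq (N : set T) h1 h2 : measure_is_complete mu ->
  measurable N -> mu N = 0%E -> (forall w, ~ N w -> h1 w = h2 w) ->
  measurable_fun setT h1 -> measurable_fun setT h2.
Proof.
move=> cmu mN N0 e12 m1 _ B mB; rewrite setTI.
have -> : h2 @^-1` B = (h1 @^-1` B `\` N) `|` (h2 @^-1` B `&` N).
  apply/seteqP; split=> w /=.
    by move=> Bw; have [Nw|nN] := pselect (N w); [right|left; split=> //; rewrite e12].
  by move=> [[+ nN]|[]//]; rewrite e12.
apply: measurableU.
  by apply: measurableD => //; rewrite -[X in measurable X]setTI; exact: m1.
by apply: cmu; exists N; split=> // w [].
Qed.

End NullSets.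

(** * Extending additive functions from a dense set *)

Section DenseExtension.
Context (R : realType) (X : normedModType R).

(** The functions to be extended live on a set closed under sums only, so additivity is all that the
    extension inherits; the bound upgrades it to real homogeneity. *)
Lemma additive_lipschitz_dual (h : X -> R) (C : R) :
  (forall x y, h (x + y) = h x + h y) -> (forall x, `|h x| <= C * `|x|) ->
  exists c : dual X, forall x, c x = h x.
Proof.
move=> hD hC.
have h0 : h 0 = 0 by have /eqP := hD 0 0; rewrite addr0 -subr_eq subrr => /eqP.
have hN x : h (- x) = - h x.
  by apply/eqP; rewrite -addr_eq0 -hD addNr h0.
have hMn x n : h (x *+ n) = n%:R * h x.
  by rewrite mulr_natl; elim: n => [|n IH]; rewrite ?mulr0n// !mulrS hD IH.
have hZ (a : R) x : h (a *: x) = a * h x.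
  wlog a0 : a / 0 <= a => [H|].
    have [/H//|/ltW a0] := leP 0 a.
    by have := H (- a); rewrite oppr_ge0 scaleNr mulNr hN => /(_ a0)/oppr_inj.
  (* n (h (a x) - a h x) stays bounded, since n a is within 1 of an integer. *)
  pose K := `|C| * `|x| + `|h x|.
  have bd n : n%:R * `|h (a *: x) - a * h x| <= K.
    pose k := Num.trunc (n%:R * a).
    have na0 : 0 <= n%:R * a by exact: mulr_ge0.
    have /andP[k1 k2] := truncn_itv na0.
    have kb : `|n%:R * a - k%:R| <= 1.
      by rewrite ger0_norm ?subr_ge0// lerBlDr -natr1 addrC in k2 *; exact: ltW.
    rewrite -[n%:R]ger0_norm// -normrM.
    have -> : n%:R * (h (a *: x) - a * h x) =
        h ((n%:R * a - k%:R) *: x) - (n%:R * a - k%:R) * h x.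
      rewrite scalerBl hD hN scaler_nat hMn -scalerA scaler_nat hMn.
      by ring.
    rewrite (le_trans (ler_normB _ _))// lerD//.
      rewrite (le_trans (hC _))// normrZ (le_trans (ler_wpM2r _ (ler_norm C)))//.
      by rewrite ler_wpM2l// ler_piMl.
    by rewrite normrM ler_piMl.
  apply/eqP; rewrite -subr_eq0 -normr_eq0; apply/negP => /negP n0.
  have {}n0 : 0 < `|h (a *: x) - a * h x| by rewrite lt_neqAle eq_sym n0 normr_ge0.
  have := bd (Num.trunc (K / `|h (a *: x) - a * h x|)).+1.
  by rewrite -ler_pdivlMr// leNgt truncnS_gt.
have lin : linear (h : X -> R^o) by move=> a x y; rewrite hD hZ.
by exists (Dual (bounded_linear_dual lin hC)).
Qed.

(* McShane's formula extends a Lipschitz function off the dense set Q. *)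
Lemma dense_additive_extension (Q : set X) (phi : X -> R) (C : R) : 0 <= C ->
  (forall x e, 0 < e -> exists2 y, Q y & `|x - y| < e) ->
  Q 0 -> (forall x y, Q x -> Q y -> Q (x + y)) ->
  (forall x y, Q x -> Q y -> phi (x + y) = phi x + phi y) ->
  (forall x y, Q x -> Q y -> phi x - phi y <= C * `|x - y|) ->
  exists c : dual X, (forall x, Q x -> c x = phi x) /\
    forall x y, `|c x - c y| <= C * `|x - y|.
Proof.
move=> C0 dQ Q0 QD phiD phiC.
pose E x := [set phi y + C * `|x - y| | y in Q].
pose h x := inf (E x).
have Elb x y : Q y -> lbound (E x) (phi y - C * `|x - y|).
  move=> Qy _ [z Qz <-]; have := phiC y z Qy Qz => h1.
  have : `|y - z| <= `|x - y| + `|x - z|.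
    by rewrite -(subrKA x) distrC (le_trans (ler_normD _ _))// [`|y - x|]distrC.
  move=> /(ler_wpM2l C0); rewrite mulrDr => h2; lra.
have E0 x : E x !=set0 by exists (phi 0 + C * `|x - 0|), 0.
have infE x : has_inf (E x) by split=> //; exists (phi 0 - C * `|x - 0|); exact: Elb.
have hQ x : Q x -> h x = phi x.
  move=> Qx; apply/eqP; rewrite eq_le; apply/andP; split.
    apply: ge_inf; first by case: (infE x).
    by exists x => //; rewrite subrr normr0 mulr0 addr0.
  apply: lb_le_inf => // z Ez; have := Elb x x Qx z Ez.
  by rewrite subrr normr0 mulr0 subr0.
have hle x y : h x <= h y + C * `|x - y|.
  rewrite -lerBlDr; apply: lb_le_inf => // _ [z Qz <-].
  have : h x <= phi z + C * `|x - z|.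
    by apply: ge_inf; [case: (infE x)|exists z].
  have : `|x - z| <= `|x - y| + `|y - z| by rewrite -(subrKA y) ler_normD.
  move=> /(ler_wpM2l C0); rewrite mulrDr => h1 h2; lra.
have hL x y : `|h x - h y| <= C * `|x - y|.
  rewrite ler_norml; apply/andP; split.
    by have := hle y x; rewrite distrC => h1; lra.
  by have := hle x y => h1; lra.
have hD x y : h (x + y) = h x + h y.
  apply/eqP; rewrite -subr_eq0 -normr_le0; apply/ler_addgt0Pr => e e0; rewrite add0r.
  have C1 : 0 < C + 1 by rewrite ltr_wpDl.
  (* Replacing x and y by points of Q produces four errors e/4: two from x + y, one each from x and
     y. The 1 covers the case C = 0. *)
  have e4 : 0 < e / 4 / (C + 1) by rewrite !divr_gt0.
  have Ce z : z < e / 4 / (C + 1) -> C * z <= e / 4.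
    move=> ze; apply: (@le_trans _ _ (C * (e / 4 / (C + 1)))).
      by rewrite ler_wpM2l// ltW.
    rewrite mulrCA ler_piMr ?divr_ge0 ?(ltW e0)//.
    by rewrite ler_pdivrMr// mul1r lerDl.
  have [x' Qx' xx'] := dQ x _ e4; have [y' Qy' yy'] := dQ y _ e4.
  have h1 := le_trans (hL x x') (Ce _ xx').
  have h2 := le_trans (hL y y') (Ce _ yy').
  have h3 : `|h (x + y) - h (x' + y')| <= e / 4 + e / 4.
    rewrite (le_trans (hL _ _))// opprD addrACA.
    rewrite (le_trans (ler_wpM2l C0 (ler_normD _ _)))// mulrDr.
    by rewrite lerD// Ce.
  have h4 : h (x' + y') = h x' + h y' by rewrite !hQ//; [exact: phiD|exact: QD].
  have -> : h (x + y) - (h x + h y) =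
    (h (x + y) - h (x' + y')) - ((h x - h x') + (h y - h y')) by rewrite h4; ring.
  rewrite (le_trans (ler_normB _ _))//.
  have := le_trans (ler_normD _ _) (lerD h1 h2).
  move: h3; move: `|h (x + y) - _| `|_ + _| => a b; lra.
have h0 : h 0 = 0 by have /eqP := hD 0 0; rewrite addr0 -subr_eq subrr => /eqP.
have [c cE] : exists c : dual X, forall x, c x = h x.
  apply: (additive_lipschitz_dual hD (C := C)) => x.
  by have := hL x 0; rewrite h0 !subr0.
by exists c; split=> [x Qx|x y]; rewrite !cE; [exact: hQ|exact: hL].
Qed.

End DenseExtension.

(** * Gelfand integrals *)

(** For n > |x| the vector x/n lies in the open unit ball, and n copies of a point of D within e/n
    of it add up to a point within e of x. Sums alone, without scalars or differences, are thus
    dense. *)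
Lemma dense_sums (R : realType) (X : normedModType R) (D : set X) (x : X) (e : R) :
  dense_in_unit_ball D -> 0 < e ->
  exists l : seq (set_type D), `|x - \sum_(a <- l) val a| < e.
Proof.
move=> [_ dD] e0; pose n := (Num.trunc `|x|).+1.
have n0 : 0 < n%:R :> R by rewrite ltr0n.
have xn : ball 0 1 (n%:R^-1 *: x).
  rewrite -ball_normE /= sub0r normrN normrZ ger0_norm ?invr_ge0 ?ltW//.
  by rewrite mulrC ltr_pdivrMr// mul1r truncnS_gt.
have en : 0 < e / n%:R by exact: divr_gt0.
have [a [Da]] := dD _ xn _ (nbhsx_ballx _ _ en).
rewrite -ball_normE /= => xa.
exists (nseq n (SigSub (mem_set Da))).
have -> : \sum_(b <- nseq n (SigSub (mem_set Da) : set_type D)) val b = a *+ n.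
  by rewrite big_nseq iter_addr_0.
have -> : x - a *+ n = n%:R *: (n%:R^-1 *: x - a).
  by rewrite scalerBr scalerA divff ?gt_eqF// scale1r scaler_nat.
by rewrite normrZ ger0_norm ?ltW// mulrC -ltr_pdivlMr.
Qed.

Lemma dual_eq_dense (R : realType) (X : normedModType R) (D : set X)
    (c c' : dual X) : dense_in_unit_ball D ->
  (forall a : set_type D, c (val a) = c' (val a)) -> c = c'.
Proof.
move=> dD cc'; apply: dual_eq => x; apply/eqP; rewrite -subr_eq0 -normr_le0.
apply/ler_addgt0Pr => e e0; rewrite add0r.
have e20 : 0 < e / 2 by rewrite divr_gt0.
have /cvgrPdist_lt/(_ _ e20) h := @dual_continuous _ _ c x.
have /cvgrPdist_lt/(_ _ e20) h' := @dual_continuous _ _ c' x.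
have [r /= r0 rh] : nbhs_ball x [set y | `|c x - c y| < e / 2 /\ `|c' x - c' y| < e / 2].
  by rewrite nbhs_ballE; apply: filterS2 h h'.
have [l xl] := dense_sums x dD r0.
have [|h1 h2] := rh (\sum_(a <- l) val a); first by rewrite -ball_normE.
have e' : c (\sum_(a <- l) val a) = c' (\sum_(a <- l) val a).
  by rewrite !dual_sumr; apply: eq_bigr => a _; exact: cc'.
have -> : c x - c' x = (c x - c (\sum_(a <- l) val a)) - (c' x - c' (\sum_(a <- l) val a)).
  by rewrite e' opprB addrA subrK.
rewrite (le_trans (ler_normB _ _))// [leRHS]splitr lerD// ltW//.
Qed.

Section GelfandIntegral.
Context d (T : measurableType d) (R : realType).
Context (mu : {finite_measure set T -> \bar R}) (X : normedModType R).
Implicit Types (f : T -> dual X) (c : dual X) (x y : X).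

Lemma is_gelfand_integralP f c : is_gelfand_integral mu setT f c <->
  forall x, mu.-integrable setT (EFin \o (fun w => f w x)) /\
    c x = \int[mu]_w f w x.
Proof.
split=> fc x; have [ifx cx] := fc x; split=> //; first by rewrite /Rintegral -cx.
by rewrite cx /Rintegral fineK//; exact: integrable_fin_num.
Qed.

Variable psi : T -> R.
Hypothesis ipsi : mu.-integrable setT (EFin \o psi).
Hypothesis psi0 : forall w, 0 <= psi w.

Let M := \int[mu]_w psi w.

Lemma dominated_integrable (h : T -> R) (r : R) : measurable_fun setT h ->
  (forall w, `|h w| <= psi w * r) ->
  mu.-integrable setT (EFin \o h) /\
  forall A, measurable A -> `|\int[mu]_(w in A) h w| <= r * \int[mu]_(w in A) psi w.
Proof.
move=> mh hr.
have ipr : mu.-integrable setT (EFin \o (fun w => psi w * r)).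
  by have := integrableZr measurableT r ipsi.
have ih : mu.-integrable setT (EFin \o h).
  apply: (le_integrable measurableT _ _ ipr); first exact/measurable_EFinP.
  by move=> w _ /=; rewrite lee_fin (le_trans (hr w))// ler_norm.
split=> // A mA.
have sub g : mu.-integrable setT (EFin \o g) -> mu.-integrable A (EFin \o g).
  exact: integrableS.
rewrite mulrC -RintegralZr//; last exact: sub.
rewrite (le_trans (le_normr_Rintegral mA (sub _ ih)))//.
apply: le_Rintegral => //.
- by have := integrable_abse (sub _ ih).
- exact: sub.
Qed.

Section Bounded.
Variable G : T -> set (dual X).
Hypothesis Gpsi : forall w c x, G w c -> `|c x| <= psi w * `|x|.

Lemma selection_bound f c : {ae mu, forall w, G w (f w)} ->
  (forall x, measurable_fun setT (fun w => f w x : R)) ->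
  forall x, mu.-integrable setT (EFin \o (fun w => f w x)) /\
    forall A, measurable A ->
      `|\int[mu]_(w in A) f w x| <= `|x| * \int[mu]_(w in A) psi w.
Proof.
move=> [N [mN N0 GN]] mf x.
have fG w : ~ N w -> G w (f w) by move=> nN; apply: contrapT => /GN.
pose h w := f w x * \1_(~` N) w.
have mh : measurable_fun setT h.
  by apply: measurable_funM => //; exact/measurable_indicP/measurableC.
have [|ih hM] := @dominated_integrable h `|x| mh.
  move=> w; rewrite /h indicE; have [/set_mem nN|_] := boolP (w \in ~` N).
    by rewrite mulr1; apply: Gpsi; exact: fG.
  by rewrite mulr0 normr0 mulr_ge0.
have hf w : ~ N w -> h w = f w x.
  by move=> nN; rewrite /h indicE mem_set// mulr1.
have [ifx fh] := Rintegral_null_eq mN N0 hf ih (mf x).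
by split=> // A mA; rewrite fh//; exact: hM.
Qed.

(** Integrable boundedness is what makes the integral exist: x |-> int f w x is linear and bounded
    by [M] times |x|, hence a weak* integral in the dual. *)
Lemma selection_integral f : {ae mu, forall w, G w (f w)} ->
  (forall x, measurable_fun setT (fun w => f w x : R)) ->
  exists2 c, multi_integral mu G c & is_gelfand_integral mu setT f c.
Proof.
move=> fG mf; have fb := selection_bound 0 fG mf.
pose c0 x := \int[mu]_w f w x.
have lc : linear (c0 : X -> R^o).
  move=> a x y; rewrite /c0.
  under eq_Rintegral do rewrite dualDr dualZr.
  rewrite RintegralD//; [|by have := integrableZl measurableT a (fb x).1|exact: (fb y).1].
  by rewrite RintegralZl//; exact: (fb x).1.
have cM x : `|c0 x| <= M * `|x| by rewrite mulrC; exact: (fb x).2.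
pose c := Dual (bounded_linear_dual lc cM).
have fc : is_gelfand_integral mu setT f c.
  by apply/is_gelfand_integralP => x; split=> //; exact: (fb x).1.
by exists c => //; exists f => //; split=> //; split=> //; exists c.
Qed.

Lemma multi_integral_bound c x : multi_integral mu G c -> `|c x| <= M * `|x|.
Proof.
move=> [f [[mf _] fG] /is_gelfand_integralP/(_ x)[_ ->]].
by rewrite mulrC; apply: (selection_bound 0 fG mf x).2.
Qed.

End Bounded.

End GelfandIntegral.

(** * The two inclusions between the weak* closure and the integral of the hull *)

Section ClosureOfIntegral.
Context d (T : measurableType d) (R : realType).
Context (mu : {finite_measure set T -> \bar R}) (X : normedModType R).
Context (D : set X) (Gamma : T -> set (dual X)) (psi : T -> R).
Hypothesis mu_complete : measure_is_complete mu.
Hypothesis mu_nonatomic : nonatomic mu.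
Hypothesis denseD : dense_in_unit_ball D.
Hypothesis stableD : union_stable mu (set_type D).
Hypothesis ipsi : mu.-integrable setT (EFin \o psi).
Hypothesis psi0 : forall w, 0 <= psi w.
Hypothesis Gpsi : forall w (c : dual X) x, Gamma w c -> `|c x| <= psi w * `|x|.
Hypothesis mGamma : measurable_multi Gamma.

Let s x w := dual_max x (Gamma w).
Let coGamma w := closure (convex_hull (Gamma w)).
Let M := \int[mu]_w psi w.

Let wGamma w : wstar_compact (Gamma w).
Proof. by case: mGamma. Qed.

Let ms x : measurable_fun setT (s x).
Proof. exact: (mGamma.2 x). Qed.

Lemma coGammaP w c : coGamma w c <-> forall x, c x <= s x w.
Proof. exact: dual_max_closure_convex_hull (wGamma w). Qed.

Let s_le x w : `|s x w| <= psi w * `|x|.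
Proof.
by have [_ [c Gc cx]] := dual_max_attained x (wGamma w); rewrite /s -cx; exact: Gpsi.
Qed.

Let s_int x := dominated_integrable ipsi (ms x) (s_le x).

Lemma coGamma_bound w (c : dual X) x : coGamma w c -> `|c x| <= psi w * `|x|.
Proof.
move=> /coGammaP cs; rewrite ler_norml; apply/andP; split.
  rewrite lerNl -dualNr (le_trans (cs _))// (le_trans (ler_norm _))//.
  by rewrite (le_trans (s_le _ _))// normrN.
by rewrite (le_trans (cs _))// (le_trans (ler_norm _)).
Qed.

Lemma exists_support_selection x : exists f : T -> dual X,
  [/\ forall w, Gamma w (f w),
    forall y, measurable_fun setT (fun w => f w y : R) &
    forall w, f w x = s x w].
Proof.
apply: (exists_maximal_selection (dir := val) x stableD) => // c c'.
exact: dual_eq_dense.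
Qed.

Let M0 : 0 <= M.
Proof. by apply: Rintegral_ge0 => w _; exact: psi0. Qed.

(** The selections are glued, [f2] on a set [B] and [f1] off it, where [B] carries nearly the
    proportion t of the integral of f2 - f1 in each direction of xs; c - c1 is then the integral of
    f2 - f1 over [B]. *)
Lemma multi_integral_almost_convex (xs : seq X) (c1 c2 : dual X) (t e : R) :
  multi_integral mu Gamma c1 -> multi_integral mu Gamma c2 ->
  0 <= t -> t <= 1 -> 0 < e -> exists2 c : dual X, multi_integral mu Gamma c &
    forall x, x \in xs -> `|c x - (c1 x + t * (c2 x - c1 x))| <= e.
Proof.
move=> [f1 [[mf1 _] G1] /is_gelfand_integralP i1].
move=> [f2 [[mf2 _] G2] /is_gelfand_integralP i2] t0 t1 e0.
have ih x : mu.-integrable setT (EFin \o (fun w => f2 w x - f1 w x)).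
  by have := integrableB measurableT (i2 x).1 (i1 x).1.
have [B mB BP] := approximate_lyapunov t0 t1 mu_nonatomic
  (xs := xs) (h := fun x w => f2 w x - f1 w x) e0 (fun x _ => ih x).
pose f w := if w \in B then f2 w else f1 w.
have fE x w : f w x = f1 w x + (f2 w x - f1 w x) * \1_B w.
  rewrite /f indicE; case: (w \in B); first by rewrite mulr1 addrC subrK.
  by rewrite mulr0 addr0.
have mf x : measurable_fun setT (fun w => f w x : R).
  under eq_fun do rewrite fE.
  apply: measurable_funD => //; apply: measurable_funM; first exact: measurable_funB.
  exact/measurable_indicP.
have Gf : {ae mu, forall w, Gamma w (f w)}.
  by apply: filterS2 G1 G2 => w g1 g2; rewrite /f; case: ifP.
have [c Ic /is_gelfand_integralP fc] := selection_integral ipsi psi0 Gpsi Gf mf.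
exists c => // x xin; have [ifx ->] := fc x.
have -> : \int[mu]_w f w x = c1 x + \int[mu]_(w in B) (f2 w x - f1 w x).
  under eq_Rintegral do rewrite fE.
  rewrite RintegralD//; last 2 first.
    exact: (i1 x).1.
    apply: (eq_integrable _ (EFin \o (fun w => f w x - f1 w x))) => //.
      by move=> w _ /=; rewrite fE addrAC subrr add0r.
    by have := integrableB measurableT ifx (i1 x).1.
  rewrite -(i1 x).2; congr (_ + _).
  rewrite [RHS]Rintegral_mkcond; apply: eq_Rintegral => w _.
  by rewrite patchE indicE; case: ifP; rewrite ?mulr1 ?mulr0.
have := BP x xin; rewrite [X in _ - t * X]RintegralB//; [|exact: (i2 x).1|exact: (i1 x).1].
by rewrite -(i2 x).2 -(i1 x).2 opprD addrACA subrr add0r.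
Qed.

Lemma integral_coGamma_sub_closure :
  multi_integral mu coGamma `<=` closure (multi_integral mu Gamma).
Proof.
move=> p [g [[mg _] Gg] /is_gelfand_integralP ig].
have pM : forall x, `|p x| <= M * `|x|.
  move=> x; apply: (multi_integral_bound ipsi psi0 coGamma_bound).
  exists g; last exact/is_gelfand_integralP.
  by split=> //; split=> //; exists p; exact/is_gelfand_integralP.
apply/dual_closureP => xs e e0.
pose K := [set (c : X -> R) | c in multi_integral mu Gamma].
have IM c x : multi_integral mu Gamma c -> `|c x| <= M * `|x|.
  exact: multi_integral_bound.
have supp (y : X) : exists2 c : dual X, multi_integral mu Gamma c & p y <= c y.
  have [f [Gf mf fy]] := exists_support_selection y.
  have [|c Ic /is_gelfand_integralP fc] :=
    selection_integral ipsi psi0 Gpsi (f := f) _ mf; first exact: aeW.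
  exists c => //; rewrite (fc y).2 (ig y).2.
  have [N [mN N0 gN]] := Gg.
  apply: (le_Rintegral_null mN N0) => //; [|exact: (ig y).1|exact: (fc y).1].
  move=> w nN; rewrite fy; have /coGammaP : coGamma w (g w); last exact.
  by apply: contrapT => /gN.
have [|||||k [c Ic <-] cx] := @approx_separation R X xs K p
    (\sum_(x <- xs) (M * `|x| + M * `|x|)) _ _ _ _ _ e e0.
- by have [c Ic _] := supp 0; exists c, c.
- by apply: sumr_ge0 => x _; rewrite addr_ge0// mulr_ge0.
- move=> _ x [c Ic <-] xin; rewrite (big_rem x)//=.
  rewrite (le_trans (ler_normB _ _))//.
  rewrite (le_trans (lerD (pM x) (IM c x Ic)))// lerDl.
  by apply: sumr_ge0 => y _; rewrite addr_ge0// mulr_ge0.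
- move=> _ _ t e' [c1 Ic1 <-] [c2 Ic2 <-] t0 t1 e'0.
  have e'20 : 0 < e' / 2 by rewrite divr_gt0.
  have [c Ic cP] := multi_integral_almost_convex xs Ic1 Ic2 t0 t1 e'20.
  exists c; first by exists c.
  by move=> x xin; rewrite (le_lt_trans (cP x xin))// ltr_pdivrMr// ltr_pMr// ltr1n.
(* The linear form a on the coordinates is evaluation at the vector sum of the a x *: x, and [supp]
   applies to that vector. *)
- move=> a; have [c Ic] := supp (\sum_(x <- xs) a x *: x).
  rewrite !dual_sumr => h; exists c; first by exists c.
  move: h; under eq_bigr do rewrite dualZr.
  by under [X in _ <= X]eq_bigr do rewrite dualZr.
by exists c.
Qed.

(* The vector measures A |-> int_A f of selections f whose integrals approach c
   converge along an ultrafilter; g x is the density of the limit. *)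
Lemma closure_integral_density c : closure (multi_integral mu Gamma) c ->
  exists g : X -> T -> R, [/\
    forall x, mu.-integrable setT (EFin \o g x),
    forall x y A, measurable A -> \int[mu]_(w in A) g (x + y) w =
      \int[mu]_(w in A) g x w + \int[mu]_(w in A) g y w,
    forall x A, measurable A -> \int[mu]_(w in A) g x w <= \int[mu]_(w in A) s x w &
    forall x, \int[mu]_w g x w = c x].
Proof.
move=> clc.
pose sel (U : set (dual X)) := [set f : T -> dual X | gelfand_selections mu Gamma f /\
  exists2 c', U c' & is_gelfand_integral mu setT f c'].
(* Generated by the sets of selections with integral in a given neighbourhood of c; membership of c
   in the closure keeps them nonempty. An ultrafilter refining it still sends the integrals to c. *)
have FF : ProperFilter (filter_from (nbhs c) sel).
  apply: filter_from_proper; last first.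
    by move=> U /clc[c' [[f Sf fc'] Uc']]; exists f; split=> //; exists c'.
  apply: filter_from_filter; first by exists setT; exact: filterT.
  move=> U V nU nV; exists (U `&` V); first exact: filterI.
  by move=> f [Sf [c' [Uc' Vc'] fc']]; split; split=> //; exists c'.
have [F [FU subF]] := ultraFilterLemma FF.
have FS : F (gelfand_selections mu Gamma).
  by apply: subF; exists setT; [exact: filterT|move=> f []].
have Sb f x : gelfand_selections mu Gamma f ->
    mu.-integrable setT (EFin \o (fun w => f w x)) /\
    forall A, measurable A ->
      `|\int[mu]_(w in A) f w x| <= `|x| * \int[mu]_(w in A) psi w.
  by move=> [[mf _] Gf]; exact: (selection_bound ipsi psi0 Gpsi).
(* The limit exists because all selections obey the same bound on A, and it inherits that bound. The
   value 0 for nonmeasurable A is a placeholder. *)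
have nuP (xA : X * set T) : exists l : R, measurable xA.2 ->
    ((fun f : T -> dual X => \int[mu]_(w in xA.2) f w xA.1) @ F --> l) /\
    `|l| <= `|xA.1| * \int[mu]_(w in xA.2) psi w.
  case: xA => x A; have [mA|nA] := pselect (measurable A); last by exists 0.
  have [|l lP] := @ultra_bounded_cvg R _ F
    (fun f : T -> dual X => \int[mu]_(w in A) f w x)
    (`|x| * \int[mu]_(w in A) psi w) FU.
    by apply: filterS FS => f Sf; exact: (Sb f x Sf).2.
  by exists l.
have [nu' nu'P] := choice nuP.
pose nu x A := nu' (x, A).
have nu_cvg x A : measurable A ->
    (fun f : T -> dual X => \int[mu]_(w in A) f w x) @ F --> nu x A.
  by move=> mA; have [] := nu'P (x, A) mA.
have nu_le x A : measurable A -> `|nu x A| <= `|x| * \int[mu]_(w in A) psi w.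
  by move=> mA; have [] := nu'P (x, A) mA.
have sub A (h : T -> R) : measurable A -> mu.-integrable setT (EFin \o h) ->
    mu.-integrable A (EFin \o h) by move=> mA; exact: integrableS.
have nuU x A B : measurable A -> measurable B -> A `&` B = set0 ->
    nu x (A `|` B) = nu x A + nu x B.
  move=> mA mB AB; have mAB : measurable (A `|` B) by exact: measurableU.
  apply: (cvg_unique _ (nu_cvg x _ mAB)) => //.
  apply: cvg_trans (cvgD (nu_cvg x A mA) (nu_cvg x B mB)).
  apply: near_eq_cvg; apply: filterS FS => f Sf; rewrite Rintegral_setU//.
    exact: sub (Sb f x Sf).1.
  by apply/disj_setPS; rewrite AB.
have nuD x y A : measurable A -> nu (x + y) A = nu x A + nu y A.
  move=> mA; apply: (cvg_unique _ (nu_cvg (x + y) _ mA)) => //.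
  apply: cvg_trans (cvgD (nu_cvg x A mA) (nu_cvg y A mA)).
  apply: near_eq_cvg; apply: filterS FS => f Sf.
  transitivity (\int[mu]_(w in A) f w x + \int[mu]_(w in A) f w y); first by [].
  rewrite -RintegralD//; [|exact: sub (Sb f _ Sf).1..].
  by apply: eq_Rintegral => w _; rewrite dualDr.
have nu_s x A : measurable A -> nu x A <= \int[mu]_(w in A) s x w.
  move=> mA; apply: (closed_cvg (fun r : R => r <= _) (@closed_le R _) _ _ (nu_cvg x A mA)).
  apply: filterS FS => f Sf; have [_ [N [mN N0 GN]]] := Sf.
  apply: (le_Rintegral_null mN N0) => //; last 2 first.
  - exact: (Sb f x Sf).1.
  - exact: (s_int x).1.
  by move=> w nN; apply: dual_max_ub => //; apply: contrapT => /GN.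
have nu_c x : nu x setT = c x.
  apply: (cvg_unique _ (nu_cvg x _ measurableT)) => //.
  apply/cvgrPdist_lt => e e0.
  apply: subF; exists [set c' : dual X | `|c x - c' x| < e].
    by have /cvgrPdist_lt/(_ _ e0) := @dual_eval_continuous _ _ x c; exact.
  by move=> f [Sf [c' /= cc' /is_gelfand_integralP/(_ x)[_ <-]]].
have gP x : exists g : T -> R, mu.-integrable setT (EFin \o g) /\
    forall A, measurable A -> nu x A = \int[mu]_(w in A) g w.
  apply: (dominated_additive_density (psi := fun w => `|x| * psi w)).
  - by have := integrableZl measurableT `|x| ipsi.
  - exact: nuU.
  - move=> A mA; rewrite RintegralZl//; first exact: nu_le.
    exact: sub.
have [g gE] := choice gP.
exists g; split=> [x|x y A mA|x A mA|x]; first by case: (gE x).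
- by rewrite -!(gE _).2// nuD.
- by rewrite -(gE _).2// nu_s.
- by rewrite -(gE _).2// nu_c.
Qed.

(* By the additivity of mu, one null set serves for all sums of elements of D. *)
Lemma additive_density_selection (g : X -> T -> R) :
  (forall x, mu.-integrable setT (EFin \o g x)) ->
  (forall x y A, measurable A -> \int[mu]_(w in A) g (x + y) w =
    \int[mu]_(w in A) g x w + \int[mu]_(w in A) g y w) ->
  (forall x A, measurable A ->
    \int[mu]_(w in A) g x w <= \int[mu]_(w in A) s x w) ->
  exists f : T -> dual X, (forall w, coGamma w (f w)) /\
    forall x, exists N, [/\ measurable N, mu N = 0%E &
      forall w, ~ N w -> f w x = g x w].
Proof.
move=> ig gD gs.
have mg x : measurable_fun setT (g x).
  by apply/measurable_EFinP; exact: (measurable_int mu (ig x)).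
have sub A (h : T -> R) : measurable A -> mu.-integrable setT (EFin \o h) ->
    mu.-integrable A (EFin \o h) by move=> mA; exact: integrableS.
have igD x y : mu.-integrable setT (EFin \o (fun w => g x w + g y w)).
  by have := integrableD measurableT (ig x) (ig y).
have igB x y : mu.-integrable setT (EFin \o (fun w => g x w - g y w)).
  by have := integrableB measurableT (ig x) (ig y).
(* The failures of additivity in either direction, and of g x - g y <= s (x - y). Each is null for
   fixed x and y, by comparing integrals over all measurable sets. *)
pose Z1 x y := [set w | g (x + y) w < g x w + g y w].
pose Z2 x y := [set w | g x w + g y w < g (x + y) w].
pose Z3 x y := [set w | s (x - y) w < g x w - g y w].
have mZ1 x y : measurable (Z1 x y).
  by apply: measurable_lt_fun => //; exact: measurable_funD.
have mZ2 x y : measurable (Z2 x y).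
  by apply: measurable_lt_fun => //; exact: measurable_funD.
have mZ3 x y : measurable (Z3 x y).
  by apply: measurable_lt_fun => //; exact: measurable_funB.
have Z10 x y : mu (Z1 x y) = 0%E.
  apply: integral_le_null => // A mA.
  by rewrite RintegralD//; [rewrite gD|exact: sub..].
have Z20 x y : mu (Z2 x y) = 0%E.
  apply: integral_le_null => // A mA.
  by rewrite RintegralD//; [rewrite gD|exact: sub..].
have Z30 x y : mu (Z3 x y) = 0%E.
  apply: integral_le_null => //; first exact: (s_int _).1.
  move=> A mA; rewrite RintegralB//; [|exact: sub..].
  (* x is written as (x - y) + y, as g is additive only under the integral sign so far. *)
  by rewrite -[X in g X](subrK y x) gD// addrK; exact: gs.
pose sg (l : seq (set_type D)) : X := \sum_(a <- l) val a.
(* The natural number selects the kind of failure, so that a single family covers all three. *)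
pose Z (p : seq (set_type D) * seq (set_type D) * nat) :=
  let: (l, l', n) := p in
  match n with 0%N => Z1 | 1%N => Z2 | _ => Z3 end (sg l) (sg l').
have stZ : union_stable mu (seq (set_type D) * seq (set_type D) * nat).
  apply: union_stable_prod; last exact: union_stable_nat.
  by apply: union_stable_prod; exact: union_stable_seq.
have mZ p : measurable (Z p).
  by case: p => -[l l'] [|[|n]]; [exact: mZ1|exact: mZ2|exact: mZ3].
have Z0 p : mu (Z p) = 0%E.
  by case: p => -[l l'] [|[|n]]; [exact: Z10|exact: Z20|exact: Z30].
have [mN /(_ Z0) N0] := stZ Z mZ.
set N := \bigcup_p Z p in mN N0.
have sgD l l' : sg (l ++ l') = sg l + sg l' by rewrite /sg big_cat.
have s_lip x y w : s y w <= s x w + psi w * `|x - y|.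
  have [_ [c Gc cy]] := dual_max_attained y (wGamma w).
  rewrite /s -cy -[y in c y](subrK x) dualDr addrC lerD//; first exact: dual_max_ub.
  by rewrite distrC (le_trans (ler_norm _))//; exact: Gpsi.
have fP w : exists c : dual X, coGamma w c /\ (~ N w -> forall l, c (sg l) = g (sg l) w).
  have [Nw|nN] := pselect (N w).
    have [[c Gc] _ _] := wGamma w; exists c; split=> //.
    by apply/coGammaP => x; exact: dual_max_ub.
  have nZ l l' n : ~ Z (l, l', n) w by move=> Zw; apply: nN; exists (l, l', n).
  have gDw l l' : g (sg l + sg l') w = g (sg l) w + g (sg l') w.
    apply/eqP; rewrite eq_le; apply/andP; split; rewrite leNgt; apply/negP.
      exact: (nZ l l' 1%N).
    exact: (nZ l l' 0%N).
  have gBw l l' : g (sg l) w - g (sg l') w <= s (sg l - sg l') w.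
    by rewrite leNgt; apply/negP; exact: (nZ l l' 2%N).
  have sg0 : sg [::] = 0 by rewrite /sg big_nil.
  have [|||||c [cg cL]] := @dense_additive_extension R X (range sg) (g^~ w) (psi w) (psi0 w).
  - move=> x e e0; have [l xl] := dense_sums x denseD e0.
    by exists (sg l) => //; exists l.
  - by exists [::].
  - by move=> _ _ [l _ <-] [l' _ <-]; exists (l ++ l').
  - by move=> _ _ [l _ <-] [l' _ <-].
  - move=> _ _ [l _ <-] [l' _ <-]; rewrite (le_trans (gBw l l'))//.
    by rewrite (le_trans (ler_norm _)).
  exists c; split=> [|_ l]; last by apply: cg; exists l.
  apply/coGammaP => x; apply/ler_addgt0Pr => e e0.
  (* One [psi w] is the Lipschitz constant of c, the other that of s in its direction; the 1 keeps
     the denominator positive. *)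
  have p1 : 0 < psi w + psi w + 1 by rewrite ltr_wpDl// addr_ge0.
  have [l xl] := dense_sums x denseD (divr_gt0 e0 p1).
  have h1 : c (sg l) <= s (sg l) w.
    rewrite cg; last by exists l.
    have g0 : g 0 w = 0.
      by have /eqP := gDw [::] [::]; rewrite sg0 addr0 -subr_eq subrr => /eqP.
    by have := gBw l [::]; rewrite sg0 g0 !subr0.
  have h2 := s_lip x (sg l) w.
  have h3 := le_trans (ler_norm _) (cL x (sg l)).
  have h4 : (psi w + psi w) * `|x - sg l| <= e.
    have {}xl : `|x - sg l| * (psi w + psi w + 1) < e by rewrite -ltr_pdivlMr.
    by rewrite (le_trans _ (ltW xl))// mulrC ler_wpM2l// lerDl.
  rewrite mulrDl in h4; lra.
have [f fE] := choice fP.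
exists f; split=> [w|x]; first by case: (fE w).
have lP k : exists l, `|x - sg l| < k.+1%:R^-1 by exact: dense_sums.
have [l lx] := choice lP.
(* A general x is not a sum from D, so it needs a null set of its own. Off this countable union and
   [N], both f w x and g x w lie within psi w * |x - sg (l k)| of g (sg (l k)) w for every k, hence
   they agree. *)
pose Y (p : nat * bool) := if p.2 then Z3 x (sg (l p.1)) else Z3 (sg (l p.1)) x.
have stY : union_stable mu (nat * bool).
  apply: union_stable_prod; first exact: union_stable_nat.
  apply: (union_stable_image (f := odd)); last exact: union_stable_nat.
  by case; [exists 1%N|exists 0%N].
have mYp p : measurable (Y p) by case: p => k []; exact: mZ3.
have Yp0 p : mu (Y p) = 0%E by case: p => k []; exact: Z30.
have [mY /(_ Yp0) Y0] := stY Y mYp.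
exists (N `|` \bigcup_p Y p); split; first exact: measurableU.
  have : (mu (N `|` \bigcup_p Y p) <= mu N + mu (\bigcup_p Y p))%E.
    exact: measureU2.
  by rewrite N0 Y0 adde0 => h; apply/eqP; rewrite eq_le h measure_ge0.
move=> w /not_orP[nN nY]; apply/eqP; rewrite -subr_eq0 -normr_le0.
apply/ler_addgt0Pr => e e0; rewrite add0r.
have p1 : 0 < psi w + psi w + 1 by rewrite ltr_wpDl// addr_ge0.
pose k := Num.trunc (e / (psi w + psi w + 1))^-1.
have xk : `|x - sg (l k)| * (psi w + psi w + 1) <= e.
  rewrite -ler_pdivlMr// (le_trans (ltW (lx k)))// ltW//.
  by rewrite invf_plt ?posrE ?divr_gt0// truncnS_gt.
have b1 : g x w - g (sg (l k)) w <= s (x - sg (l k)) w.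
  by rewrite leNgt; apply/negP => h; apply: nY; exists (k, true).
have b2 : g (sg (l k)) w - g x w <= s (sg (l k) - x) w.
  by rewrite leNgt; apply/negP => h; apply: nY; exists (k, false).
have b3 := le_trans (ler_norm _) (s_le (x - sg (l k)) w).
have b4 := le_trans (ler_norm _) (s_le (sg (l k) - x) w).
have [cf cg] := fE w; have := coGamma_bound (x - sg (l k)) cf.
rewrite dualBr cg// !ler_norml => /andP[b5 b6].
rewrite [`|sg _ - x|]distrC in b4.
rewrite mulrDr mulr1 mulrDr ![`|_| * psi w]mulrC in xk.
have b7 := normr_ge0 (x - sg (l k)).
apply/andP; split; lra.
Qed.

(** For each x the selection agrees with the measurable density g x only off a null set depending on
    x; completeness of mu turns this into scalar measurability, and the integrals are unaffected. *)
Lemma closure_integral_sub_coGamma :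
  closure (multi_integral mu Gamma) `<=` multi_integral mu coGamma.
Proof.
move=> c /closure_integral_density[g [ig gD gs gc]].
have [f [Gf fg]] := additive_density_selection ig gD gs.
have key x : measurable_fun setT (fun w => f w x : R) /\
    mu.-integrable setT (EFin \o (fun w => f w x)) /\ c x = \int[mu]_w f w x.
  have [N [mN N0 fgN]] := fg x.
  have gfN w : ~ N w -> g x w = f w x by move=> /fgN.
  have mf : measurable_fun setT (fun w => f w x : R).
    apply: (complete_measurable_null_eq mu_complete mN N0 gfN).
    by apply/measurable_EFinP; exact: (measurable_int mu (ig x)).
  have [ifx fgE] := Rintegral_null_eq mN N0 gfN (ig x) mf.
  by split=> //; split=> //; rewrite fgE// gc.
have fc : is_gelfand_integral mu setT f c.
  by apply/is_gelfand_integralP => x; case: (key x).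
exists f => //; split; last exact: aeW.
by split; [move=> x; case: (key x)|exists c].
Qed.

End ClosureOfIntegral.

Lemma dual_norm_bound (R : realType) (X : normedModType R) (c : dual X) (r : R) :
  (dual_norm c <= r%:E)%E -> 0 <= r /\ forall x, `|c x| <= r * `|x|.
Proof.
move=> cr.
have h x : `|x| <= 1 -> `|c x| <= r.
  move=> x1; rewrite -lee_fin (le_trans _ cr)//.
  by apply: ereal_sup_ubound; exists x.
split=> [|x]; first by have := h 0; rewrite normr0 dual0r normr0; apply.
have [->|x0] := eqVneq x 0; first by rewrite dual0r !normr0 mulr0.
have nx0 : 0 < `|x| by rewrite normr_gt0.
have := h (`|x|^-1 *: x); rewrite normrZ dualZr normrM normfV normr_id.
by rewrite mulVf ?gt_eqF// mulrC ler_pdivrMr//; apply.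
Qed.

Lemma convex_multi_integral d (T : measurableType d) (R : realType)
    (mu : {finite_measure set T -> \bar R}) (X : normedModType R)
    (G : T -> set (dual X)) :
  (forall w, convex_set (G w)) -> convex_set (multi_integral mu G).
Proof.
move=> cG; apply/convex_setP => a b t t0 t1.
move=> [f [[mf _] Gf] /is_gelfand_integralP fa] [g [[mg _] Gg] /is_gelfand_integralP gb].
pose h w : dual X := t *: f w + (1 - t) *: g w.
have hE x w : h w x = t * f w x + (1 - t) * g w x by [].
have ih : is_gelfand_integral mu setT h (t *: a + (1 - t) *: b).
  apply/is_gelfand_integralP => x.
  have i1 : mu.-integrable setT (EFin \o (fun w => t * f w x)).
    by have := integrableZl measurableT t (fa x).1.
  have i2 : mu.-integrable setT (EFin \o (fun w => (1 - t) * g w x)).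
    by have := integrableZl measurableT (1 - t) (gb x).1.
  split; first by have := integrableD measurableT i1 i2.
  under eq_Rintegral do rewrite hE.
  rewrite RintegralD// !RintegralZl//; [|exact: (gb x).1|exact: (fa x).1].
  by rewrite -(fa x).2 -(gb x).2.
exists h => //; split; first split.
- move=> x; under eq_fun do rewrite hE.
  by apply: measurable_funD; apply: measurable_funM.
- by exists (t *: a + (1 - t) *: b).
- by apply: filterS2 Gf Gg => w Gfw Ggw; apply: (convex_setP (G w)).1.
Qed.

Unset Implicit Arguments.
Set Strict Implicit.
Set Printing Implicit Defensive.

Theorem theorem2p8 (R : realType) (d : measure_display)
    (Omega : measurableType d) (mu : {finite_measure set Omega -> \bar R})
    (X : completeNormedModType R) (Gamma : Omega -> set (dual X)) :
  measure_is_complete mu ->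
  nonatomic mu ->
  asplund X ->
  dens_lt_additivity mu X ->
  integrably_bounded mu Gamma ->
  multi_wstar_scalarly_measurable Gamma ->
  multi_gelfand_integrable mu Gamma ->
  (forall w, Gamma w !=set0) ->
  (forall w, closed (Gamma w)) ->
  [/\ compact (closure (multi_integral mu Gamma)),
      convex_set (closure (multi_integral mu Gamma)) &
      closure (multi_integral mu Gamma) =
      multi_integral mu (fun w => closure (convex_hull (Gamma w)))].
Proof.
move=> cmu natom _ [D [[dD _] ltD]] [psi [ipsi bG]] msG _ G0 clG.
have bd w c : Gamma w c -> 0 <= psi w /\ forall x, `|c x| <= psi w * `|x|.
  move=> Gc; apply: dual_norm_bound; apply: le_trans (bG w).
  by apply: ereal_sup_ubound; exists c.
have psi0 w : 0 <= psi w by have [c /bd[]] := G0 w.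
have Gpsi w (c : dual X) x : Gamma w c -> `|c x| <= psi w * `|x|.
  by move=> /bd[].
have wG w : wstar_compact (Gamma w).
  split=> //; apply: (banach_alaoglu (M := psi w)) => // c Gc x.
  exact: Gpsi.
have mG : measurable_multi Gamma.
  split=> // x; apply/measurable_EFinP.
  rewrite (_ : _ \o _ = fun w => support_fun x (Gamma w)); first exact: msG.
  by apply/funext => w /=; have [-> _] := dual_max_attained x (wG w).
have stD := union_stable_lt_additivity ltD.
have e : closure (multi_integral mu Gamma) =
    multi_integral mu (fun w => closure (convex_hull (Gamma w))).
  apply/seteqP; split.
    exact: (closure_integral_sub_coGamma cmu dD stD ipsi psi0 Gpsi mG).
  exact: (integral_coGamma_sub_closure natom dD stD ipsi psi0 Gpsi mG).
split=> //.
  (* The bound by the integral of psi holds for integrals of selections of the hull, and [e] carries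
     it over to the closure. *)
  apply: (banach_alaoglu (M := \int[mu]_w psi w)); first exact: closed_closure.
  rewrite e => c Ic x; apply: (multi_integral_bound ipsi psi0 _ x Ic).
  exact: coGamma_bound.
(* Convexity is read off from the integral of the hull, whose values are intersections of the
   half-spaces c x <= dual_max x (Gamma w). *)
rewrite e; apply: convex_multi_integral => w; apply/convex_setP => a b t t0 t1.
move=> /(dual_max_closure_convex_hull _ (wG w)) ha /(dual_max_closure_convex_hull _ (wG w)) hb.
apply/(dual_max_closure_convex_hull _ (wG w)) => x.
rewrite (_ : dual_max x _ = t * dual_max x (Gamma w) + (1 - t) * dual_max x (Gamma w)); last by ring.
by apply: lerD; apply: ler_wpM2l; rewrite ?subr_ge0//; [exact: ha|exact: hb].
Qed.
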